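(* Let $\mathcal{C}$ be an $A_\infty$-category over a field $K$, fix SDR data on $\mathcal{C}$, and let $a\in\{1,2\}$. Let $\mathcal{D}$ and $\mathfrak{f}:\mathcal{D}\to\mathcal{C}$ be the $A_\infty$-category and the $A_\infty$-quasi-isomorphism functor produced by the HPT construction from these SDR data. Then $\mathfrak{f}$ induces an $A_\infty$-quasi-isomorphism functor $\tilde{\mathfrak{f}}^{(a)}:\tilde{\mathcal{D}}^{(a)}\to\tilde{\mathcal{C}}^{(a)}$ between the additive enlargements. Let further $\tilde{\mathcal{E}}$ and $\tilde{\mathfrak{g}}:\tilde{\mathcal{E}}\to\tilde{\mathcal{C}}^{(a)}$ be the $A_\infty$-category and the $A_\infty$-quasi-isomorphism functor produced by applying the HPT construction to $\tilde{\mathcal{C}}^{(a)}$ with the induced SDR data. Then $$\tilde{\mathcal{E}}=\tilde{\mathcal{D}}^{(a)},\qquad \tilde{\mathfrak{g}}=\tilde{\mathfrak{f}}^{(a)}.$$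
   Context: All vector spaces are over a fixed field $K$. **$A_\infty$-categories (suspended notation).** An $A_\infty$-category $\mathcal{C}$ consists of a set of objects, a $\mathbb{Z}$-graded vector space $\mathcal{C}(X,Y)=\oplus_r\mathcal{C}^r(X,Y)$ for each pair of objects, and, writing $s\mathcal{C}(X,Y)$ for the suspension ($s:\mathcal{C}^r(X,Y)\to (s\mathcal{C}(X,Y))^{r-1}$, $\bar\alpha:=s(\alpha)$, $|\bar\alpha|=|\alpha|-1$), degree $1$ multilinear maps $b_n:s\mathcal{C}(X_1,X_2)\otimes\cdots\otimes s\mathcal{C}(X_n,X_{n+1})\to s\mathcal{C}(X_1,X_{n+1})$, $n\ge1$, such that for every $n\ge 1$ and homogeneous composable $\bar a_1,\dots,\bar a_n$, $$0=\sum_{k+l=n+1}\sum_{j=0}^{k-1}(-1)^{|\bar a_1|+\cdots+|\bar a_j|}b_k(\bar a_1,\dots,\bar a_j,b_l(\bar a_{j+1},\dots,\bar a_{j+l}),\bar a_{j+l+1},\dots,\bar a_n).$$ No unitality is assumed. The differential on $\mathcal{C}(X,Y)$ is $d_{XY}:=m_1=s^{-1}b_1s$. **$A_\infty$-functors.** An $A_\infty$-functor $\mathfrak{f}=\{f;f_1,f_2,\dots\}:\mathcal{D}\to\mathcal{C}$ is a map $f$ on objects with degree $0$ multilinear maps $f_k:s\mathcal{D}(X_1,X_2)\otimes\cdots\otimes s\mathcal{D}(X_k,X_{k+1})\to s\mathcal{C}(f(X_1),f(X_{k+1}))$, $k\ge1$, such that for all $n\ge1$ and homogeneous composable $\bar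 a_1,\dots,\bar a_n$, $$\sum_{i\ge1}\sum_{j_1+\cdots+j_i=n}b^{\mathcal{C}}_i(f_{j_1}(\bar a_1,\dots,\bar a_{j_1}),\dots,f_{j_i}(\dots,\bar a_n))=\sum_{k+l=n+1}\sum_{j=0}^{k-1}(-1)^{|\bar a_1|+\cdots+|\bar a_j|}f_k(\bar a_1,\dots,\bar a_j,b^{\mathcal{D}}_l(\bar a_{j+1},\dots,\bar a_{j+l}),\dots,\bar a_n),$$ where all $j_1,\dots,j_i\ge 1$. It is an $A_\infty$-quasi-isomorphism functor if $f$ is bijective on objects and every $f_1:s\mathcal{D}(X,Y)\to s\mathcal{C}(f(X),f(Y))$ induces an isomorphism on $b_1$-cohomology. **SDR data.** Strong deformation retract (SDR) data on $\mathcal{C}$ consist, for every pair of objects $Y,Z$, of a graded vector space $\mathcal{D}(Y,Z)$, degree $0$ maps $\iota_{YZ}:\mathcal{D}(Y,Z)\to\mathcal{C}(Y,Z)$, $\pi_{YZ}:\mathcal{C}(Y,Z)\to\mathcal{D}(Y,Z)$ and a degree $-1$ map $h_{YZ}$ on $\mathcal{C}(Y,Z)$, such that, with $d^{\mathcal{D}}_{YZ}:=\pi_{YZ}d_{YZ}\iota_{YZ}$, $\mathcal{D}(Y,Z)$ is a complex, $\iota_{YZ},\pi_{YZ}$ are chain maps, $\pi_{YZ}\iota_{YZ}=\mathrm{Id}$ and $d_{YZ}h_{YZ}+h_{YZ}d_{YZ}=\mathrm{Id}-\iota_{YZ}\pi_{YZ}$. The same symbols denote the maps on suspended spaces obtained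 by conjugating with $s$ (without signs). **HPT (homological perturbation theory) construction.** From SDR data on $\mathcal{C}$ one gets an $A_\infty$-category $\mathcal{D}$ with the same objects as $\mathcal{C}$ and morphism spaces $\mathcal{D}(Y,Z)$, and an $A_\infty$-quasi-isomorphism functor $\mathfrak{f}:\mathcal{D}\to\mathcal{C}$, identity on objects, by (suppressing object indices) $f_1=\iota$, $b_1^{\mathcal{D}}=d^{\mathcal{D}}$, and inductively for $n\ge1$ $$f_{n+1}=-h\sum_{j\ge2}\sum_{k_1+\cdots+k_j=n+1}b^{\mathcal{C}}_j(f_{k_1}\otimes\cdots\otimes f_{k_j}),\qquad b^{\mathcal{D}}_{n+1}=\pi\sum_{j\ge2}\sum_{k_1+\cdots+k_j=n+1}b^{\mathcal{C}}_j(f_{k_1}\otimes\cdots\otimes f_{k_j}).$$ (It is a known fact that this does give an $A_\infty$-category and an $A_\infty$-quasi-isomorphism functor.) **Additive enlargements $\tilde{\mathcal{C}}^{(a)}$, $a=1,2$.** Objects are finite formal direct sums $X_1[r_1]\oplus\cdots\oplus X_l[r_l]$ with $X_i\in\mathcal{C}$, $r_i\in\mathbb{Z}$. Morphism spaces are the direct sums (matrices) of the spaces $\tilde{\mathcal{C}}^r(X[n],Y[m]):=\mathcal{C}^{r+m-n}(X,Y)$. For $\alpha\in\mathcal{C}(X,Y)$, $\alpha'$ denotes the same element regarded in $\tilde{\mathcal{C}}(X[n],Y[m])$ (so $|\alpha'|=|\alpha|+n-m$), and $\bar\alpha':=s(\alpha')$. The $A_\infty$-structure is the multilinear extension (summing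 over intermediate direct summands, as in matrix multiplication) of $$\tilde b^{(1)}_k(\bar\alpha'_{12},\dots,\bar\alpha'_{k(k+1)})=(-1)^{r_1}\bigl(b_k(\bar\alpha_{12},\dots,\bar\alpha_{k(k+1)})\bigr)',$$ $$\tilde b^{(2)}_k(\bar\alpha'_{12},\dots,\bar\alpha'_{k(k+1)})=(-1)^{r_1+\cdots+r_k}\bigl(b_k(\bar\alpha_{12},\dots,\bar\alpha_{k(k+1)})\bigr)',$$ for $\bar\alpha_{i(i+1)}\in s\mathcal{C}(X_i,X_{i+1})$ and $\bar\alpha'_{i(i+1)}\in s\tilde{\mathcal{C}}(X_i[r_i],X_{i+1}[r_{i+1}])$. Both $\tilde{\mathcal{C}}^{(1)}$ and $\tilde{\mathcal{C}}^{(2)}$ are $A_\infty$-categories. **Induced functor.** For an $A_\infty$-functor $\mathfrak{f}:\mathcal{D}\to\mathcal{C}$ and $a=1$ or $2$, the functor $\tilde{\mathfrak{f}}^{(a)}:\tilde{\mathcal{D}}^{(a)}\to\tilde{\mathcal{C}}^{(a)}$ is given on objects by $\oplus_iX_i[r_i]\mapsto\oplus_if(X_i)[r_i]$ and on morphisms by the matrix-wise multilinear extension of $$\tilde f^{(a)}_k(\bar\alpha'_{12},\dots,\bar\alpha'_{k(k+1)})=\bigl(f_k(\bar\alpha_{12},\dots,\bar\alpha_{k(k+1)})\bigr)'.$$ **Induced SDR data on $\tilde{\mathcal{C}}^{(a)}$.** The retract graded spaces are $\tilde{\mathcal{D}}(\mathcal{X},\mathcal{Y})$ (direct sums of $\tilde{\mathcal{D}}^r(Y[n],Z[m])=\mathcal{D}^{r+m-n}(Y,Z)$),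 and entrywise, for $\alpha$ in $\mathcal{C}(Y,Z)$ or $\mathcal{D}(Y,Z)$ as appropriate and $\alpha'$ the corresponding morphism $Y[n]\to Z[m]$: $\tilde\iota(\alpha')=(\iota_{YZ}(\alpha))'$, $\tilde\pi(\alpha')=(\pi_{YZ}(\alpha))'$, $\tilde h(\alpha')=(-1)^{n}(h_{YZ}(\alpha))'$.
   Formalization: For a=2 the induced functor is taken with the sign (-1)^{r_2+...+r_k} in front of (f_k(...))', since the sign-free formula makes the claim false when char K is not 2; for a=1 the formula is unchanged. *)

(* Defs.v *)
From HB Require Import structures.
From mathcomp Require Import all_boot all_order all_algebra.

Set Implicit Arguments.
Unset Strict Implicit.
Unset Printing Implicit Defensive.

Import GRing.Theory.
Local Open Scope ring_scope.

Definition dprod (K : fieldType) (I : finType) (V : I -> lmodType K) : Type :=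
  {dffun forall i : I, V i}.

Section DProd.
Variables (K : fieldType) (I : finType) (V : I -> lmodType K).

Definition dprod_of (F : forall i, V i) : dprod V := [ffun i => F i].
Definition entry (i : I) (u : dprod V) : V i := u i.

Lemma dprodE F i : entry i (dprod_of F) = F i.
Proof. by rewrite /entry ffunE. Qed.

Lemma dprodP (u v : dprod V) : (forall i, entry i u = entry i v) <-> u = v.
Proof. by split=> [e | -> //]; apply/ffunP. Qed.

HB.instance Definition _ :=
  Choice.copy (dprod V) {dffun forall i : I, (V i : choiceType)}.

Let dzero : dprod V := dprod_of (fun i => 0).
Let dopp (u : dprod V) : dprod V := dprod_of (fun i => - entry i u).
Let dadd (u v : dprod V) : dprod V := dprod_of (fun i => entry i u + entry i v).
Let dscale (k : K) (u : dprod V) : dprod V := dprod_of (fun i => k *: entry i u).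

Fact dprod_addA : associative dadd.
Proof. by move=> u v w; apply/dprodP=> i; rewrite !dprodE addrA. Qed.
Fact dprod_addC : commutative dadd.
Proof. by move=> u v; apply/dprodP=> i; rewrite !dprodE addrC. Qed.
Fact dprod_add0 : left_id dzero dadd.
Proof. by move=> u; apply/dprodP=> i; rewrite !dprodE add0r. Qed.
Fact dprod_addN : left_inverse dzero dopp dadd.
Proof. by move=> u; apply/dprodP=> i; rewrite !dprodE addNr. Qed.

HB.instance Definition _ := GRing.isZmodule.Build (dprod V)
  dprod_addA dprod_addC dprod_add0 dprod_addN.

Fact dprod_scaleA k l u : dscale k (dscale l u) = dscale (k * l) u.
Proof. by apply/dprodP=> i; rewrite !dprodE scalerA. Qed.
Fact dprod_scale1 : left_id 1 dscale.
Proof. by move=> u; apply/dprodP=> i; rewrite !dprodE scale1r. Qed.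
Fact dprod_scaleDr : right_distributive dscale +%R.
Proof. by move=> k u v; apply/dprodP=> i; rewrite !dprodE scalerDr. Qed.
Fact dprod_scaleDl u : {morph dscale^~ u : k l / k + l}.
Proof. by move=> k l; apply/dprodP=> i; rewrite !dprodE scalerDl. Qed.

HB.instance Definition _ := GRing.Zmodule_isLmodule.Build K (dprod V)
  dprod_scaleA dprod_scale1 dprod_scaleDr dprod_scaleDl.

Fact entry_linear i : linear (entry i).
Proof. by move=> k u v; rewrite /GRing.scale /GRing.add /= !dprodE. Qed.

HB.instance Definition _ i :=
  GRing.isLinear.Build K (dprod V) (V i) _ (entry i) (entry_linear i).

End DProd.

Section DMap.
Variables (K : fieldType) (I : finType) (V W : I -> lmodType K).
Variables (c : I -> K) (F : forall i, {linear V i -> W i}).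

Definition dmap (u : dprod V) : dprod W :=
  dprod_of (fun i => c i *: F i (entry i u)).

Fact dmap_linear : linear dmap.
Proof.
move=> k u v; apply/dprodP=> i.
by rewrite linearP /= !dprodE !linearP.
Qed.

HB.instance Definition _ :=
  GRing.isLinear.Build K (dprod V) (dprod W) _ dmap dmap_linear.

End DMap.

(* A vector space with an internal direct sum decomposition indexed by int;
   gdeg r is the subspace of homogeneous elements of degree r. *)
Record gvect (K : fieldType) := GVect {
  gsort :> lmodType K;
  gdeg : int -> gsort -> Prop;
  gdeg0 : forall r, gdeg r 0;
  gdegP : forall r k u v, gdeg r u -> gdeg r v -> gdeg r (k *: u + v);
  gdeg_span : forall v, exists (s : seq int) (w : int -> gsort),
    [/\ uniq s, forall r, gdeg r (w r) & v = \sum_(r <- s) w r];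
  gdeg_indep : forall (s : seq int) (w : int -> gsort),
    uniq s -> (forall r, gdeg r (w r)) -> \sum_(r <- s) w r = 0 ->
    forall r, r \in s -> w r = 0
}.

(* The finite direct sum of the V i, the i-th one regraded so that its degree
   r component is V_i^(r + c i). *)
Section GSum.
Variables (K : fieldType) (I : finType) (V : I -> gvect K) (c : I -> int).

Definition gsum_deg (r : int) (u : dprod V) : Prop :=
  forall i, gdeg (r + c i) (entry i u).

Fact gsum_deg0 r : gsum_deg r 0.
Proof. by move=> i; rewrite linear0; apply: gdeg0. Qed.

Fact gsum_degP r k u v : gsum_deg r u -> gsum_deg r v -> gsum_deg r (k *: u + v).
Proof. by move=> hu hv i; rewrite linearP; apply: gdegP. Qed.

Fact gsum_deg_span (u : dprod V) : exists (s : seq int) (w : int -> dprod V),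
  [/\ uniq s, forall r, gsum_deg r (w r) & u = \sum_(r <- s) w r].
Proof.
have /fin_all_exists [s /fin_all_exists [w hsw]] i :
    exists (s : seq int) (w : int -> V i),
    [/\ uniq s, forall r, gdeg r (w r) & entry i u = \sum_(r <- s) w r].
  exact: gdeg_span.
pose S := undup (flatten [seq [seq r - c i | r <- s i] | i <- enum I]).
exists S, (fun r => dprod_of (fun i =>
  if r + c i \in s i then w i (r + c i) else 0)); split.
- exact: undup_uniq.
- move=> r i; rewrite dprodE; case: ifP => _; last exact: gdeg0.
  by case: (hsw i).
apply/dprodP=> i; rewrite linear_sum; have [us _ ->] := hsw i.
under [RHS]eq_bigr do rewrite /= dprodE.
rewrite -big_mkcond -[RHS]big_filter.
rewrite -(big_map (fun r => r + c i) xpredT (w i)); apply: perm_big.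
apply: uniq_perm => //.
  rewrite map_inj_uniq; last exact: addIr.
  by rewrite filter_uniq // undup_uniq.
move=> r; apply/idP/mapP => [rs | [q]].
  exists (r - c i); last by rewrite subrK.
  rewrite mem_filter subrK rs mem_undup /=; apply/flatten_mapP.
  by exists i; rewrite ?mem_enum //; apply: map_f.
by rewrite mem_filter => /andP[qs _] ->.
Qed.

Fact gsum_deg_indep (s : seq int) (w : int -> dprod V) :
  uniq s -> (forall r, gsum_deg r (w r)) -> \sum_(r <- s) w r = 0 ->
  forall r, r \in s -> w r = 0.
Proof.
move=> us hw sw0 r rs; apply/dprodP=> i; rewrite linear0.
pose t := [seq q + c i | q <- s].
have ut : uniq t by rewrite map_inj_uniq //; exact: addIr.
have hv q : gdeg q (entry i (w (q - c i))).
  by rewrite -{1}[q](subrK (c i)); apply: hw.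
have := gdeg_indep ut hv; rewrite big_map.
under eq_bigr do rewrite addrK.
rewrite -linear_sum sw0 linear0 => /(_ erefl (r + c i)).
by rewrite addrK; apply; apply: map_f.
Qed.

Definition gsum : gvect K :=
  GVect gsum_deg0 gsum_degP gsum_deg_span gsum_deg_indep.

End GSum.

(* npath H X Y: nonempty sequences a_1, ..., a_n with a_i in H X_i X_(i+1),
   X_1 = X and X_(n+1) = Y. A family of n-ary operations (n >= 1) on such
   sequences is encoded as a single function on npath. *)
Inductive npath (O : Type) (H : O -> O -> Type) : O -> O -> Type :=
| pone X Y : H X Y -> npath H X Y
| pcons X Y Z : H X Y -> npath H Y Z -> npath H X Z.

Arguments pone {O H X Y} a.
Arguments pcons {O H X Y Z} a p.

Section Paths.
Variables (O : Type) (H : O -> O -> Type).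

Fixpoint plen X Y (p : npath H X Y) : nat :=
  match p with
  | pone _ _ _ => 1
  | pcons _ _ _ _ q => (plen q).+1
  end.

(* The ways to cut p into two nonempty pieces. *)
Fixpoint psplits X Y (p : npath H X Y) :
    seq {Z : O & (npath H X Z * npath H Z Y)%type} :=
  match p in npath _ X Y
    return seq {Z : O & (npath H X Z * npath H Z Y)%type} with
  | pone _ _ _ => [::]
  | pcons X Y Z a q =>
      existT _ Y (pone a, q) ::
      [seq existT _ (tag d) (pcons a (tagged d).1, (tagged d).2)
         | d <- psplits q]
  end.

(* The ways to cut p into consecutive nonempty blocks. *)
Fixpoint blockings X Y (p : npath H X Y) : seq (npath (npath H) X Y) :=
  match p in npath _ X Y return seq (npath (npath H) X Y) with
  | pone X Y a => [:: pone (pone a)]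
  | pcons X Y Z a q => flatten
      [seq [:: pcons (pone a) B;
               match B in npath _ Y' Z'
                 return H X Y' -> npath (npath H) X Z' with
               | pone _ _ r => fun a => pone (pcons a r)
               | pcons _ _ _ r B' => fun a => pcons (pcons a r) B'
               end a] | B <- blockings q]
  end.

(* All pairs (j, (a_1, .., a_j, F(a_(j+1), .., a_(j+l)), a_(j+l+1), .., a_n))
   with l >= 1, for p = (a_1, .., a_n). *)
Fixpoint contractions (F : forall X Y, npath H X Y -> H X Y) X Y
    (p : npath H X Y) : seq (nat * npath H X Y) :=
  (0%N, pone (F _ _ p)) ::
  [seq (0%N, pcons (F _ _ (tagged d).1) (tagged d).2) | d <- psplits p] ++
  match p in npath _ X Y return seq (nat * npath H X Y) with
  | pone _ _ _ => [::]
  | pcons _ _ _ a q => [seq (jr.1.+1, pcons a jr.2) | jr <- contractions F q]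
  end.

End Paths.

Fixpoint npmap (O O' : Type) (H : O -> O -> Type) (H' : O' -> O' -> Type)
    (f : O -> O') (F : forall X Y, H X Y -> H' (f X) (f Y)) X Y
    (p : npath H X Y) : npath H' (f X) (f Y) :=
  match p in npath _ X Y return npath H' (f X) (f Y) with
  | pone _ _ a => pone (F _ _ a)
  | pcons _ _ _ a q => pcons (F _ _ a) (npmap F q)
  end.

Record gquiver (K : fieldType) := GQuiver {
  ob : Type;
  Mor : ob -> ob -> gvect K
}.

Arguments Mor {K} g X Y.

Notation paths Q := (npath (fun X Y => gsort (Mor Q X Y))).

(* The suspension s is the identity on elements, so that sC(X,Y) is C(X,Y)
   with degrees lowered by one. *)
Definition sdeg (K : fieldType) (V : gvect K) (r : int) (v : V) : Prop :=
  gdeg (r + 1) v.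

Section Operations.
Variables (K : fieldType) (Q : gquiver K).

(* ds lists the suspended degrees of the homogeneous arrows of p. *)
Fixpoint pdeg X Y (p : paths Q X Y) (ds : seq int) : Prop :=
  match p, ds with
  | pone _ _ a, [:: d] => sdeg d a
  | pcons _ _ _ a q, d :: ds' => sdeg d a /\ pdeg q ds'
  | _, _ => False
  end.

(* lincomb k p q r: the three sequences agree except in one position, where
   the arrow of r is k times that of p plus that of q. *)
Inductive lincomb (k : K) : forall X Y : ob Q,
    paths Q X Y -> paths Q X Y -> paths Q X Y -> Prop :=
| lincomb_one X Y (a a' : Mor Q X Y) :
    lincomb k (pone a) (pone a') (pone (k *: a + a'))
| lincomb_head X Y Z (a a' : Mor Q X Y) (p : paths Q Y Z) :
    lincomb k (pcons a p) (pcons a' p) (pcons (k *: a + a') p)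
| lincomb_tail X Y Z (a : Mor Q X Y) (p q r : paths Q Y Z) :
    lincomb k p q r -> lincomb k (pcons a p) (pcons a q) (pcons a r).

Definition multilinear X Y (V : lmodType K) (F : paths Q X Y -> V) : Prop :=
  forall k p q r, lincomb k p q r -> F r = k *: F p + F q.

Definition of_degree (e : int) X Y (V : gvect K) (F : paths Q X Y -> V) : Prop :=
  forall p ds, pdeg p ds -> sdeg (\sum_(d <- ds) d + e) (F p).

End Operations.

Definition koszul (K : fieldType) (n : int) : K := (-1) ^ n.
Arguments koszul : clear implicits.

(* Data of an A-infinity category: bop restricted to sequences of length n is
   b_n. *)
Record ainf_pre (K : fieldType) := AinfPre {
  quiv :> gquiver K;
  bop : forall X Y : ob quiv, paths quiv X Y -> Mor quiv X Y
}.

Arguments bop {K} a {X Y} p.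

Section Ainf.
Variable K : fieldType.

Definition ainf_relations (C : ainf_pre K) : Prop :=
  forall (X Y : ob C) (p : paths C X Y) (ds : seq int), pdeg p ds ->
  \sum_(jq <- contractions (@bop K C) p)
     koszul K (\sum_(d <- take jq.1 ds) d) *: bop C jq.2 = 0.

Definition is_ainf_cat (C : ainf_pre K) : Prop :=
  [/\ forall X Y, multilinear (@bop K C X Y),
      forall X Y, of_degree 1 (@bop K C X Y)
    & ainf_relations C].

Definition b1 (C : ainf_pre K) (X Y : ob C) (a : Mor C X Y) : Mor C X Y :=
  bop C (pone a).

Record prefunctor (D C : gquiver K) := PreFunctor {
  fob : ob D -> ob C;
  fop : forall X Y : ob D, paths D X Y -> Mor C (fob X) (fob Y)
}.

Definition functor_relations (D C : ainf_pre K) (f : prefunctor D C) : Prop :=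
  forall (X Y : ob D) (p : paths D X Y) (ds : seq int), pdeg p ds ->
  \sum_(B <- blockings p) bop C (npmap (@fop D C f) B) =
  \sum_(jq <- contractions (@bop K D) p)
     koszul K (\sum_(d <- take jq.1 ds) d) *: fop f jq.2.

Definition is_ainf_functor (D C : ainf_pre K) (f : prefunctor D C) : Prop :=
  [/\ forall X Y, multilinear (@fop D C f X Y),
      forall X Y, of_degree 0 (@fop D C f X Y)
    & functor_relations f].

Definition cocycle (C : ainf_pre K) (X Y : ob C) (a : Mor C X Y) : Prop :=
  b1 a = 0.

Definition cohomologous (C : ainf_pre K) (X Y : ob C) (a a' : Mor C X Y) : Prop :=
  exists c : Mor C X Y, a - a' = b1 c.

(* Bijectivity of the map ker b_1 / im b_1 -> ker b_1 / im b_1 given by f_1. *)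
Definition cohomology_iso (D C : ainf_pre K) (f : prefunctor D C)
    (X Y : ob D) : Prop :=
  let f1 (a : Mor D X Y) : Mor C (fob f X) (fob f Y) := fop f (pone a) in
  [/\ forall a, cocycle a -> cocycle (f1 a),
      forall a a', cohomologous a a' -> cohomologous (f1 a) (f1 a'),
      forall a a', cocycle a -> cocycle a' ->
        cohomologous (f1 a) (f1 a') -> cohomologous a a'
    & forall c, cocycle c -> exists2 a, cocycle a & cohomologous (f1 a) c].

Definition is_ainf_qiso (D C : ainf_pre K) (f : prefunctor D C) : Prop :=
  [/\ is_ainf_functor f, bijective (fob f) & forall X Y, cohomology_iso f X Y].

End Ainf.

Record sdr_pre (K : fieldType) (C : gquiver K) := SdrPre {
  ret : ob C -> ob C -> gvect K;
  sdr_i : forall X Y, {linear ret X Y -> Mor C X Y};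
  sdr_p : forall X Y, {linear Mor C X Y -> ret X Y};
  sdr_h : forall X Y, {linear Mor C X Y -> Mor C X Y}
}.

Arguments sdr_i {K C} s {X Y}.
Arguments sdr_p {K C} s {X Y}.
Arguments sdr_h {K C} s {X Y}.

Section HPT.
Variables (K : fieldType) (C : ainf_pre K) (S : sdr_pre C).

Definition retd X Y (a : ret S X Y) : ret S X Y := sdr_p S (b1 (sdr_i S a)).

(* The differential m_1 = s^-1 b_1 s of C is b1, as s is the identity on
   elements. *)
Definition is_sdr : Prop := forall X Y : ob C,
  [/\ [/\ forall r (x : ret S X Y), gdeg r x -> gdeg r (sdr_i S x),
          forall r (a : Mor C X Y), gdeg r a -> gdeg r (sdr_p S a)
        & forall r (a : Mor C X Y), gdeg r a -> gdeg (r - 1) (sdr_h S a)],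
      (forall r (x : ret S X Y), gdeg r x -> gdeg (r + 1) (retd x)) /\
      (forall x : ret S X Y, retd (retd x) = 0),
      (forall x : ret S X Y, b1 (sdr_i S x) = sdr_i S (retd x)) /\
      (forall a : Mor C X Y, retd (sdr_p S a) = sdr_p S (b1 a)),
      forall x : ret S X Y, sdr_p S (sdr_i S x) = x
    & forall a : Mor C X Y,
        b1 (sdr_h S a) + sdr_h S (b1 a) = a - sdr_i S (sdr_p S a)].

Definition ret_quiver : gquiver K := GQuiver (ret S).

Definition map_blocks
    (F : forall X Y : ob C, paths ret_quiver X Y -> Mor C X Y)
    X Y (B : npath (paths ret_quiver) X Y) : paths C X Y :=
  npmap (H := paths ret_quiver) (f := fun X : ob C => X) F B.

(* The sum over j >= 2 and k_1 + ... + k_j = n of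
   b_j (F_(k_1) (x) ... (x) F_(k_j)). *)
Definition hpt_sum
    (F : forall X Y : ob C, paths ret_quiver X Y -> Mor C X Y)
    X Y (p : paths ret_quiver X Y) : Mor C X Y :=
  \sum_(B <- blockings p | (1 < plen B)%N)
    bop C (map_blocks F B).

(* Sequences of length at most n are evaluated correctly with fuel n; the
   recursion it implements is hpt_f_one and hpt_f_cons below. *)
Fixpoint hpt_f_rec (n : nat) (X Y : ob C) (p : paths ret_quiver X Y) : Mor C X Y :=
  match n with
  | 0 => 0
  | n'.+1 =>
    match p in npath _ X Y return Mor C X Y with
    | pone X Y a => sdr_i S a
    | pcons X Y Z a q => - sdr_h S (hpt_sum (hpt_f_rec n') (pcons a q))
    end
  end.

Definition hpt_f (X Y : ob C) (p : paths ret_quiver X Y) : Mor C X Y :=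
  hpt_f_rec (plen p) p.

Lemma hpt_f_one X Y (x : ret S X Y) :
  hpt_f (pone (H := fun X Y => ret S X Y) x) = sdr_i S x.
Proof. by []. Qed.

Let tot X Y (B : npath (paths ret_quiver) X Y) : nat :=
  (fix t X Y (B : npath (paths ret_quiver) X Y) : nat :=
     match B with
     | pone _ _ r => plen r
     | pcons _ _ _ r B' => plen r + t _ _ B'
     end) X Y B.

Let tot_blockings X Y (p : paths ret_quiver X Y) :
  all (fun B => tot B == plen p) (blockings p).
Proof.
elim: p => [// | {}X {}Y Z x q] /=.
elim: (blockings q) => //= B s IHs /andP[/eqP hB /IHs ->] {IHs}.
rewrite -hB eqxx andbT /=.
by case: B x {hB} => [? ? r | ? ? ? r B'] x; rewrite /= ?addSn eqxx.
Qed.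

Let hpt_sum_ext (n : nat) (F G : forall X Y : ob C, paths ret_quiver X Y -> Mor C X Y) :
  (forall X Y (p : paths ret_quiver X Y), (plen p <= n)%N -> F X Y p = G X Y p) ->
  forall X Y (p : paths ret_quiver X Y),
  (plen p <= n.+1)%N -> hpt_sum F p = hpt_sum G p.
Proof.
move=> FG X Y p hp; rewrite /hpt_sum.
have FGB (X' Y' : ob C) (B : npath (paths ret_quiver) X' Y') :
    (tot B <= n)%N ->
    map_blocks F B =
    map_blocks G B.
  rewrite /map_blocks; elim: B => [X1 Y1 r | X1 Y1 Z1 r B' IHB'] /= hn.
    by rewrite FG.
  by rewrite FG ?IHB' //; apply: leq_trans hn; rewrite ?leq_addl ?leq_addr.
have tot_gt0 X' Y' (B : npath (paths ret_quiver) X' Y') : (0 < tot B)%N.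
  by case: B => [? ? [] | ? ? ? []].
have plen_gt0 X' Y' (r : paths ret_quiver X' Y') : (0 < plen r)%N by case: r.
move: (tot_blockings p) hp; move: (blockings p) (plen p) => s N.
elim: s => [_ _ | B s IHs]; first by rewrite !big_nil.
case/andP => /eqP hB /IHs {}IHs hN; rewrite !big_cons IHs //.
case: ifP => // B2; congr (bop C _ + _).
case: B B2 hB => [// | X1 Y1 Z1 r B'] _ /= hB.
have := FGB _ _ B'; rewrite /map_blocks /= => e; rewrite FG ?e // -ltnS.
- by apply: leq_trans hN; rewrite -hB /= -addn1 addnC leq_add2r.
- by apply: leq_trans hN; rewrite -hB /= -addn1 leq_add2l.
Qed.

Lemma hpt_f_cons X Y Z (x : ret S X Y) (q : paths ret_quiver Y Z) :
  hpt_f (pcons x q) = - sdr_h S (hpt_sum hpt_f (pcons x q)).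
Proof.
have stable m n X' Y' (p : paths ret_quiver X' Y') :
    (plen p <= m)%N -> (plen p <= n)%N -> hpt_f_rec m p = hpt_f_rec n p.
  elim: m n X' Y' p => [|m IH] [|n] X' Y' [] //= {}X {}Y {}Z {}x {}q.
  rewrite !ltnS => qm qn; congr (- sdr_h S _).
  rewrite (@hpt_sum_ext (plen q) _ (hpt_f_rec n)) // => X1 Y1 p hp.
  by apply: IH; apply: leq_trans hp _.
rewrite /hpt_f /=; congr (- sdr_h S _).
by apply: (@hpt_sum_ext (plen q)) => // X' Y' p hp; apply: stable.
Qed.

Definition hpt_b (X Y : ob C) (p : paths ret_quiver X Y) : ret S X Y :=
  match p in npath _ X Y return ret S X Y with
  | pone X Y a => retd a
  | pcons X Y Z a q => sdr_p S (hpt_sum hpt_f (pcons a q))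
  end.

Definition hpt_cat : ainf_pre K := AinfPre (quiv := ret_quiver) hpt_b.

Definition hpt_functor : prefunctor hpt_cat C :=
  PreFunctor (D := hpt_cat) (C := C) (fob := fun X => X) hpt_f.

End HPT.

(* The formal direct sum of the X_i[r_i], i < fs_len. Primitive projections
   make an entrywise map given by the identity on objects definitionally the
   identity on formal sums. *)
#[projections(primitive)]
Record fsum (O : Type) := FSum {
  fs_len : nat;
  fs_ob : 'I_fs_len -> O;
  fs_sh : 'I_fs_len -> int
}.

Arguments fs_ob {O} f i.
Arguments fs_sh {O} f i.

Definition fsum_map (O O' : Type) (f : O -> O') (X : fsum O) : fsum O' :=
  {| fs_len := fs_len X; fs_ob := fun i => f (fs_ob X i); fs_sh := fs_sh X |}.

(* The two sign conventions a = 1 and a = 2. *)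
Variant enl_kind := Enl1 | Enl2.

(* rs = (r_1, .., r_k) are the shifts of the sources of the k inputs. *)
Definition enl_b_sign (a : enl_kind) (rs : seq int) : int :=
  match a with Enl1 => head 0 rs | Enl2 => \sum_(r <- rs) r end.

(* The sign-free formula for the induced functor is correct for a = 1 only. For
   a = 2 the signs r_1 + ... + r_k of the operations force the sign
   r_2 + ... + r_k. Already in arity two, in
   b_1 f_2 + b_2 (f_1, f_1) = f_1 b_2 + f_2 (b_1, 1) + (-1)^|a_1| f_2 (1, b_1)
   enlarging the operations multiplies the three terms containing b_1 by
   (-1)^(r_1) and the two others by (-1)^(r_1 + r_2); likewise the recursion for
   the perturbed functor gives - h b_2 (i, i) the sign r_1 + (r_1 + r_2). *)
Definition enl_f_sign (a : enl_kind) (rs : seq int) : int :=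
  match a with Enl1 => 0 | Enl2 => \sum_(r <- behead rs) r end.

Section EnlQuiver.
Variables (K : fieldType) (O : Type) (H : O -> O -> gvect K).

(* Matrices with entries X_i[n_i] -> Y_j[m_j] in H X_i Y_j; the entry of a
   matrix of degree r has degree r + m_j - n_i in H X_i Y_j. *)
Definition enl_hom (X Y : fsum O) : gvect K :=
  gsum (fun ij : 'I_(fs_len X) * 'I_(fs_len Y) => H (fs_ob X ij.1) (fs_ob Y ij.2))
       (fun ij => fs_sh Y ij.2 - fs_sh X ij.1).

Definition mxentry (X Y : fsum O) (A : enl_hom X Y) i j :
  H (fs_ob X i) (fs_ob Y j) := entry (i, j) A.

Definition enl_quiver : gquiver K := GQuiver enl_hom.

(* The choices of intermediate summands between the summands i of X and j of Y,
   each with the list of shifts of the sources and the sequence of entries. *)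
Fixpoint threads (X Y : fsum O) (P : paths enl_quiver X Y) :
    forall (i : 'I_(fs_len X)) (j : 'I_(fs_len Y)),
    seq (seq int * npath (fun A B => gsort (H A B)) (fs_ob X i) (fs_ob Y j)) :=
  match P in npath _ X Y return forall (i : 'I_(fs_len X)) (j : 'I_(fs_len Y)),
    seq (seq int * npath (fun A B => gsort (H A B)) (fs_ob X i) (fs_ob Y j)) with
  | pone X Y A => fun i j =>
      [:: ([:: fs_sh X i],
           pone (H := fun A B => gsort (H A B)) (mxentry A i j))]
  | pcons X Y Z A P' => fun i j => flatten
      [seq [seq (fs_sh X i :: t.1,
                 pcons (H := fun A B => gsort (H A B)) (mxentry A i m) t.2)
              | t <- threads P' m j] | m <- enum 'I_(fs_len Y)]
  end.

End EnlQuiver.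

Section Enlargement.
Variables (K : fieldType) (a : enl_kind).

Definition enl_b (C : ainf_pre K) (X Y : fsum (ob C))
    (P : paths (enl_quiver (Mor C)) X Y) : enl_hom (Mor C) X Y :=
  dprod_of (fun ij =>
    \sum_(t <- threads P ij.1 ij.2)
       koszul K (enl_b_sign a t.1) *: (bop C t.2 : gsort _)).

Definition enl (C : ainf_pre K) : ainf_pre K :=
  AinfPre (quiv := enl_quiver (Mor C)) (@enl_b C).

Definition enl_f (D C : ainf_pre K) (f : prefunctor D C) (X Y : fsum (ob D))
    (P : paths (enl D) X Y) :
    enl_hom (Mor C) (fsum_map (fob f) X) (fsum_map (fob f) Y) :=
  dprod_of (fun ij =>
    \sum_(t <- threads P ij.1 ij.2)
       koszul K (enl_f_sign a t.1) *: (fop f t.2 : gsort _)).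

Definition enl_functor (D C : ainf_pre K) (f : prefunctor D C) :
    prefunctor (enl D) (enl C) :=
  PreFunctor (D := enl D) (C := enl C) (fob := fsum_map (fob f)) (enl_f f).

Definition enl_sdr (C : ainf_pre K) (S : sdr_pre C) : sdr_pre (enl C) :=
  SdrPre (C := enl C) (ret := enl_hom (ret S))
    (fun X Y => dmap (fun=> 1)
       (fun ij => @sdr_i K C S (fs_ob X ij.1) (fs_ob Y ij.2)))
    (fun X Y => dmap (fun=> 1)
       (fun ij => @sdr_p K C S (fs_ob X ij.1) (fs_ob Y ij.2)))
    (fun X Y => dmap (fun ij => koszul K (fs_sh X ij.1))
       (fun ij => @sdr_h K C S (fs_ob X ij.1) (fs_ob Y ij.2))).

End Enlargement.

(* Main.v *)
(* Let F be the perturbed functor, S the sum of the b_j (F (x) ... (x) F) over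
   j >= 2 blocks, and b^D the perturbed operations. Evaluating b^C b^C = 0 on the
   sequences F(x), and using the functor equation on shorter sequences, gives
   b_1 S + S b^D = 0 on the next longer ones. Applying h and pi to this identity
   yields the functor equation (from d h + h d = 1 - iota pi) and the A-infinity
   relations of D (as pi is a chain map); no side condition on h is needed.

   For enlargements, an entry of a composite of matrices is a sum over threads of
   summands. Blockings and contractions of a sequence of matrices restrict to
   those of its threads, and the signs match modulo 2, which gives the relations
   of the enlargement of C and, by induction on the length, the two equalities.
   The statements on the enlargements of D and f then follow from perturbation
   theory over the enlargement of C. *)
Require Import Defs.
From mathcomp Require Import all_boot all_order all_algebra ring.
From Stdlib Require Import FunctionalExtensionality.

Set Implicit Arguments.
Unset Strict Implicit.
Unset Printing Implicit Defensive.

Import GRing.Theory.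
Local Open Scope ring_scope.

(** * Splittings, blockings and contractions *)

Section PathSums.
Variables (O : Type) (H : O -> O -> Type).

Lemma plen_gt0 X Y (p : npath H X Y) : (0 < plen p)%N.
Proof. by case: p. Qed.

(** Cuts and blocks of a path are shorter than it but not structural subterms, so most inductions
    below run on the length. *)
Lemma plen_ind (P : forall X Y, npath H X Y -> Prop) :
  (forall X Y (p : npath H X Y),
     (forall X' Y' (q : npath H X' Y'), (plen q < plen p)%N -> P X' Y' q) ->
     P X Y p) ->
  forall X Y (p : npath H X Y), P X Y p.
Proof.
move=> IH X Y p; have [n] := ubnP (plen p).
elim: n X Y p => // n IHn X Y p; rewrite ltnS => hp.
by apply: IH => X' Y' q hq; apply: IHn; apply: leq_trans hq hp.
Qed.

Definition ssum (M : zmodType) X Y (p : npath H X Y)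
    (g : forall Z, npath H X Z -> npath H Z Y -> M) : M :=
  \sum_(d <- psplits p) g (tag d) (tagged d).1 (tagged d).2.

Definition bsum (M : zmodType) X Y (p : npath H X Y)
    (T : npath (npath H) X Y -> M) : M :=
  \sum_(B <- blockings p) T B.

Section Zmod.
Variable M : zmodType.

Lemma ssum_one X Y (a : H X Y) g : ssum (pone a) g = 0 :> M.
Proof. exact: big_nil. Qed.

Lemma ssum_cons X Y Z (a : H X Y) (q : npath H Y Z) g :
  ssum (pcons a q) g =
  g Y (pone a) q + ssum q (fun Z u v => g Z (pcons a u) v) :> M.
Proof. by rewrite /ssum big_cons big_map. Qed.

Lemma eq_ssum X Y (p : npath H X Y) (g g' : forall Z, npath H X Z -> npath H Z Y -> M) :
  (forall Z u v, (plen u + plen v)%N = plen p -> g Z u v = g' Z u v) ->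
  ssum p g = ssum p g'.
Proof.
elim: p g g' => [{}X {}Y a | {}X {}Y Z a q IH] g g' e; first by rewrite !ssum_one.
rewrite !ssum_cons e // (IH _ (fun Z u v => g' Z (pcons a u) v)) // => W u v h.
by apply: e; rewrite /= addSn h.
Qed.

Lemma ssumD X Y (p : npath H X Y) (g g' : forall Z, npath H X Z -> npath H Z Y -> M) :
  ssum p (fun Z u v => g Z u v + g' Z u v) = ssum p g + ssum p g'.
Proof. exact: big_split. Qed.

Lemma eq_bsum X Y (p : npath H X Y) (T T' : npath (npath H) X Y -> M) :
  T =1 T' -> bsum p T = bsum p T'.
Proof. by move=> e; apply: eq_bigr => B _; apply: e. Qed.

Lemma bsumD X Y (p : npath H X Y) (T T' : npath (npath H) X Y -> M) :
  bsum p (fun B => T B + T' B) = bsum p T + bsum p T'.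
Proof. exact: big_split. Qed.

(** A blocking is either one block or a first block [u] followed by a blocking of the rest.
    [blockings] itself recurses on the first arrow; this recursion on the first block drives the
    later proofs. *)
Lemma bsum_rec X Y (p : npath H X Y) (T : npath (npath H) X Y -> M) :
  bsum p T =
  T (pone p) + ssum p (fun Z u v => bsum v (fun B => T (pcons u B))).
Proof.
elim: p T => [{}X {}Y a | {}X {}Y Z a q IH] T.
  by rewrite ssum_one addr0 /bsum big_seq1.
rewrite {1}/bsum /= big_flatten big_map.
under eq_bigr do rewrite big_cons big_seq1.
rewrite big_split /= -/(bsum q _) -/(bsum q _) [X in _ + X]IH ssum_cons.
by rewrite addrCA.
Qed.

(** Both sides run over the ways to cut [p] into three consecutive pieces. *)
Lemma ssumA X Y (p : npath H X Y)
    (g : forall Z Z', npath H X Z -> npath H Z Z' -> npath H Z' Y -> M) :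
  ssum p (fun Z' w v => ssum w (fun Z u u' => g Z Z' u u' v)) =
  ssum p (fun Z u w => ssum w (fun Z' u' v => g Z Z' u u' v)).
Proof.
elim: p g => [{}X {}Y a | {}X {}Y Z a q IH] g; first by rewrite !ssum_one.
rewrite !ssum_cons ssum_one add0r.
under [LHS]eq_ssum do rewrite ssum_cons.
by rewrite ssumD (IH (fun Z Z' u u' v => g Z Z' (pcons a u) u' v)).
Qed.

End Zmod.
End PathSums.

(** A cut between two blocks of a blocking is a cut of [p] together with independent blockings of
    the two pieces. *)
Lemma bsum_ssum (O : Type) (H : O -> O -> Type) (M : zmodType) X Y
    (p : npath H X Y)
    (g : forall Z, npath (npath H) X Z -> npath (npath H) Z Y -> M) :
  bsum p (fun B => ssum B g) =
  ssum p (fun Z u v => bsum u (fun B1 => bsum v (fun B2 => g Z B1 B2))).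
Proof.
elim/plen_ind: p g => {}X {}Y p IH g.
rewrite bsum_rec ssum_one add0r.
under [RHS]eq_ssum do rewrite bsum_rec.
rewrite ssumD (ssumA p (fun Z Z' u u' v =>
  bsum u' (fun B1 => bsum v (fun B2 => g Z' (pcons u B1) B2)))).
rewrite -ssumD; apply: eq_ssum => Z u v huv.
under eq_bsum do rewrite ssum_cons.
rewrite bsumD (IH _ _ v) //.
by rewrite -huv -{1}[plen v]add0n ltn_add2r plen_gt0.
Qed.

Section MapSums.
Variables (O O' : Type) (H : O -> O -> Type) (H' : O' -> O' -> Type).
Variables (f : O -> O') (F : forall X Y, H X Y -> H' (f X) (f Y)).

Lemma ssum_npmap (M : zmodType) X Y (p : npath H X Y)
    (g : forall Z, npath H' (f X) Z -> npath H' Z (f Y) -> M) :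
  ssum (npmap F p) g = ssum p (fun Z u v => g (f Z) (npmap F u) (npmap F v)).
Proof.
elim: p g => [{}X {}Y a | {}X {}Y Z a q IH] g; first by rewrite !ssum_one.
by rewrite /= !ssum_cons IH.
Qed.

End MapSums.

(** * Unbundled linear maps, Koszul signs and degree lists *)

Section Linear.
Variables (K : fieldType) (M N : lmodType K) (L : M -> N).
Hypothesis hL : linear L.

Lemma lin_add x y : L (x + y) = L x + L y.
Proof. by rewrite -[x]scale1r hL !scale1r. Qed.

Lemma lin0 : L 0 = 0.
Proof. by apply: (addIr (L 0)); rewrite -lin_add !add0r. Qed.

Lemma lin_scale k x : L (k *: x) = k *: L x.
Proof. by rewrite -[k *: x]addr0 hL lin0 addr0. Qed.

Lemma lin_opp x : L (- x) = - L x.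
Proof. by rewrite -scaleN1r lin_scale scaleN1r. Qed.

Lemma lin_sum (I : Type) (r : seq I) (P : pred I) (G : I -> M) :
  L (\sum_(i <- r | P i) G i) = \sum_(i <- r | P i) L (G i).
Proof. exact: (big_morph L lin_add lin0). Qed.

Lemma lin_ssum O (H : O -> O -> Type) X Y (p : npath H X Y) g :
  L (ssum p g) = ssum p (fun Z u v => L (g Z u v)).
Proof. exact: lin_sum. Qed.

Lemma lin_bsum O (H : O -> O -> Type) X Y (p : npath H X Y) T :
  L (bsum p T) = bsum p (fun B => L (T B)).
Proof. exact: lin_sum. Qed.

End Linear.

Lemma koszulD (K : fieldType) (m n : int) :
  koszul K (m + n) = koszul K m * koszul K n.
Proof. by rewrite /koszul expfzDr // oppr_eq0 oner_eq0. Qed.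

Lemma koszulN (K : fieldType) (n : int) : koszul K (- n) = koszul K n.
Proof. by rewrite /koszul -exprz_inv invrN invr1. Qed.

Lemma koszulK (K : fieldType) (n : int) : koszul K n * koszul K n = 1.
Proof. by rewrite -{1}koszulN -koszulD addNr. Qed.

Section Degrees.
Implicit Type ds : seq int.

Lemma sum_take0 ds : \sum_(d <- take 0 ds) d = 0.
Proof. by rewrite take0 big_nil. Qed.

Lemma sum_takeS n ds :
  \sum_(d <- take n.+1 ds) d = head 0 ds + \sum_(d <- take n (behead ds)) d.
Proof. by case: ds => [|d ds] /=; rewrite ?big_nil ?addr0 ?big_cons. Qed.

Lemma head_takeS n ds : head 0 (take n.+1 ds) = head 0 ds.
Proof. by case: ds. Qed.

Lemma behead_takeS n ds : behead (take n.+1 ds) = take n (behead ds).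
Proof. by case: ds. Qed.

Lemma dropS n ds : drop n.+1 ds = drop n (behead ds).
Proof. by case: ds. Qed.

End Degrees.

Section Scale.
Variables (K : fieldType) (M : lmodType K) (O : Type) (H : O -> O -> Type).

Lemma ssumZ k X Y (p : npath H X Y) (g : forall Z, npath H X Z -> npath H Z Y -> M) :
  k *: ssum p g = ssum p (fun Z u v => k *: g Z u v).
Proof. exact: scaler_sumr. Qed.

Lemma bsumZ k X Y (p : npath H X Y) (T : npath (npath H) X Y -> M) :
  k *: bsum p T = bsum p (fun B => k *: T B).
Proof. exact: scaler_sumr. Qed.

End Scale.

(** * Signed sums over contractions *)

Section Contractions.
Variables (K : fieldType) (O : Type) (H : O -> O -> Type) (M : lmodType K).
Variable G : forall X Y, npath H X Y -> H X Y.

(** With inner operation [G] and outer operation [T], this is the right-hand side of the functor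
    equation, and the A-infinity relation when [T] is [G] itself. *)
Definition csum X Y (p : npath H X Y) (ds : seq int) (T : npath H X Y -> M) : M :=
  \sum_(jq <- contractions G p) koszul K (\sum_(d <- take jq.1 ds) d) *: T jq.2.

Lemma csum_one X Y (x : H X Y) ds T :
  csum (pone x) ds T = T (pone (G (pone x))).
Proof. by rewrite /csum /= big_seq1 sum_take0 scale1r. Qed.

Lemma csum_cons X Y Z (x : H X Y) (q : npath H Y Z) ds T :
  csum (pcons x q) ds T =
  T (pone (G (pcons x q))) + ssum (pcons x q) (fun Z u v => T (pcons (G u) v)) +
  koszul K (head 0 ds) *: csum q (behead ds) (fun r => T (pcons x r)).
Proof.
rewrite /csum big_cons -/([seq _ | d <- psplits (pcons x q)]) big_cat !big_map /=.
rewrite sum_take0 scale1r -addrA scaler_sumr; congr (_ + (_ + _)).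
  by apply: eq_bigr => d _; rewrite scale1r.
by apply: eq_bigr => d _; rewrite sum_takeS koszulD scalerA.
Qed.

Lemma eq_csum X Y (p : npath H X Y) ds (T T' : npath H X Y -> M) :
  T =1 T' -> csum p ds T = csum p ds T'.
Proof. by move=> e; apply: eq_bigr => d _; rewrite e. Qed.

Lemma csumD X Y (p : npath H X Y) ds (T T' : npath H X Y -> M) :
  csum p ds (fun r => T r + T' r) = csum p ds T + csum p ds T'.
Proof. by rewrite -big_split; apply: eq_bigr => d _; rewrite /= scalerDr. Qed.

Lemma csumZ k X Y (p : npath H X Y) ds (T : npath H X Y -> M) :
  csum p ds (fun r => k *: T r) = k *: csum p ds T.
Proof.
by rewrite /csum scaler_sumr; apply: eq_bigr => d _; rewrite !scalerA mulrC.
Qed.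

Lemma csum_sum (I : finType) X Y (p : npath H X Y) ds (T : I -> npath H X Y -> M) :
  csum p ds (fun r => \sum_i T i r) = \sum_i csum p ds (T i).
Proof. by rewrite /csum exchange_big; apply: eq_bigr => d _; rewrite scaler_sumr. Qed.

Lemma csum0 X Y (p : npath H X Y) ds : csum p ds (fun=> 0) = 0.
Proof. by apply: big1 => d _; rewrite scaler0. Qed.

(** A cut of a contracted path never falls inside the contracted segment, which therefore lies in
    the left or in the right piece; in the second case the operation passes [u] and picks up its
    Koszul sign. *)
Lemma csum_ssum X Y (p : npath H X Y) ds
    (g : forall Z, npath H X Z -> npath H Z Y -> M) :
  csum p ds (fun r => ssum r g) =
  ssum p (fun Z u v =>
    csum u (take (plen u) ds) (fun u' => g Z u' v) +
    koszul K (\sum_(d <- take (plen u) ds) d) *: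
      csum v (drop (plen u) ds) (fun v' => g Z u v')).
Proof.
elim: p ds g => [{}X {}Y a | {}X {}Y Z a q IH] ds g.
  by rewrite csum_one !ssum_one.
rewrite csum_cons ssum_one add0r.
under eq_ssum do rewrite ssum_cons.
rewrite ssumD -(ssumA _ (fun Z Z' u u' v => g Z' (pcons (G u) u') v)).
under eq_csum do rewrite ssum_cons.
rewrite csumD scalerDr IH [in LHS]ssum_cons [in RHS]ssum_cons csum_one /=.
rewrite sum_takeS take0 big_nil addr0 dropS drop0 ssum_cons ssum_one add0r.
rewrite -!addrA; congr (_ + _).
rewrite !addrA addrAC [RHS]addrC; congr (_ + _); rewrite ssumZ.
rewrite -!ssumD; apply: eq_ssum => W u v _.
rewrite csum_cons /= head_takeS behead_takeS sum_takeS koszulD -scalerA dropS.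
by rewrite scalerDr !addrA; do 2!congr (_ + _).
Qed.

End Contractions.

Lemma lin_csum (K : fieldType) O (H : O -> O -> Type) (M N : lmodType K)
    (L : M -> N) G X Y (p : npath H X Y) ds T :
  linear L -> L (csum G p ds T) = csum G p ds (fun r => L (T r)).
Proof.
by move=> hL; rewrite /csum lin_sum //; apply: eq_bigr => d _; rewrite lin_scale.
Qed.

(** * Contractions against blockings *)

Lemma plen_split_lt O (H : O -> O -> Type) X Y Z (u : npath H X Z) (v : npath H Z Y) n :
  (plen u + plen v)%N = n -> (plen v < n)%N /\ (plen u < n)%N.
Proof.
by move=> <-; rewrite -{1}[plen v]add0n -{2}[plen u]addn0 ltn_add2r ltn_add2l !plen_gt0.
Qed.

Section Multilinear.
Variables (K : fieldType) (Q : gquiver K) (M : lmodType K).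
Local Notation QH := (fun X Y => gsort (Mor Q X Y)).

Lemma ml_one X Y (T : paths Q X Y -> M) :
  multilinear T -> linear (fun x => T (@pone _ QH X Y x)).
Proof. by move=> hT k x y; apply: hT; constructor. Qed.

Lemma ml_head X Y Z (T : paths Q X Z -> M) (p : paths Q Y Z) :
  multilinear T -> linear (fun x => T (@pcons _ QH X Y Z x p)).
Proof. by move=> hT k x y; apply: hT; constructor. Qed.

Lemma ml_tail X Y Z (T : paths Q X Z -> M) (x : Mor Q X Y) :
  multilinear T -> multilinear (fun p => T (@pcons _ QH X Y Z x p)).
Proof. by move=> hT k p q r h; apply: hT; constructor. Qed.

End Multilinear.

Section Insertion.
Variables (K : fieldType) (O : Type) (H : O -> O -> Type) (C : gquiver K).
Variables (f : O -> ob C) (F : forall X Y, npath H X Y -> Mor C (f X) (f Y)).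
Variable M : lmodType K.
Local Notation CH := (fun X Y => gsort (Mor C X Y)).
Local Notation mapF := (npmap (H := npath H) (H' := CH) (f := f) F).

(** The suspended degrees of the images of the blocks under a family [F] of degree 0. *)
Fixpoint bdeg X Y (B : npath (npath H) X Y) (ds : seq int) : seq int :=
  match B with
  | pone _ _ u => [:: \sum_(d <- ds) d]
  | pcons _ _ _ u B' =>
      \sum_(d <- take (plen u) ds) d :: bdeg B' (drop (plen u) ds)
  end.

(* The sum, over the blocks of B, of the signed values of T on the sequence
   obtained by applying G to that block and F to all others. *)
Fixpoint ins (G : forall X Y, npath H X Y -> seq int -> Mor C (f X) (f Y)) X Y
    (B : npath (npath H) X Y) (ds : seq int) : (paths C (f X) (f Y) -> M) -> M :=
  match B in npath _ X Y return (paths C (f X) (f Y) -> M) -> M with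
  | pone _ _ u => fun T => T (@pone _ CH _ _ (G _ _ u ds))
  | pcons _ _ _ u B' => fun T =>
      T (@pcons _ CH _ _ _ (G _ _ u (take (plen u) ds)) (mapF B')) +
      koszul K (\sum_(d <- take (plen u) ds) d) *:
        ins G B' (drop (plen u) ds) (fun P => T (@pcons _ CH _ _ _ (F u) P))
  end.

Definition insum G X Y (p : npath H X Y) ds (T : paths C (f X) (f Y) -> M) : M :=
  bsum p (fun B => ins G B ds T).

Lemma insum_rec G X Y (p : npath H X Y) ds (T : paths C (f X) (f Y) -> M) :
  insum G p ds T = T (@pone _ CH _ _ (G _ _ p ds)) + ssum p (fun Z u v =>
    bsum v (fun B => T (@pcons _ CH _ _ _ (G _ _ u (take (plen u) ds)) (mapF B))) +
    koszul K (\sum_(d <- take (plen u) ds) d) *: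
      insum G v (drop (plen u) ds) (fun P => T (@pcons _ CH _ _ _ (F u) P))).
Proof.
rewrite /insum bsum_rec /=; congr (_ + _); apply: eq_ssum => Z u v _.
by rewrite bsumD bsumZ.
Qed.

(** For [b] the operations of the target, this is the left-hand side of the functor equation. *)
Definition block_op (b : forall X Y, paths C X Y -> Mor C X Y) X Y
    (p : npath H X Y) : Mor C (f X) (f Y) := bsum p (fun B => b _ _ (mapF B)).

Lemma bsum_csum b X Y (p : npath H X Y) ds (T : paths C (f X) (f Y) -> M) :
  multilinear T ->
  bsum p (fun B => csum b (mapF B) (bdeg B ds) T) =
  insum (fun X Y p _ => block_op b p) p ds T.
Proof.
elim/plen_ind: p ds T => {}X {}Y p IH ds T hT.
rewrite bsum_rec insum_rec /= csum_one.
(* The block consisting of the whole of [p] is split according to whether its subdivision has one or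
   more blocks. *)
have -> : T (@pone _ CH _ _ (block_op b p)) =
    T (@pone _ CH _ _ (b _ _ (@pone _ CH _ _ (F p)))) +
    ssum p (fun Z u v => bsum v (fun B =>
      T (@pone _ CH _ _ (b _ _ (@pcons _ CH _ _ _ (F u) (mapF B)))))).
  rewrite /block_op bsum_rec /= (lin_add (ml_one hT)) (lin_ssum (ml_one hT)).
  by congr (_ + _); apply: eq_ssum => Z u v _; rewrite (lin_bsum (ml_one hT)).
rewrite -addrA -ssumD; congr (_ + _).
under eq_ssum => Z u v huv.
  under eq_bsum do rewrite csum_cons /= ssum_cons ssum_npmap.
  rewrite !bsumD -bsumZ IH; first last.
  - exact: ml_tail.
  - by case: (plen_split_lt huv).
  over.
rewrite !ssumD -!addrA; congr (_ + _); rewrite !addrA; congr (_ + _).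
(* Contractions of all blocks and those starting after the first block are now matched. What remains
   contracts a proper initial run, so [block_op] of that run is subdivided on the right. *)
under [in RHS]eq_ssum => Z u v _.
  under eq_bsum => B.
    rewrite /block_op bsum_rec (lin_add (ml_head _ hT)) (lin_ssum (ml_head _ hT)) /=.
    under eq_ssum do rewrite (lin_bsum (ml_head _ hT)).
    over.
  rewrite bsumD [X in _ + X]/bsum exchange_big /=.
  over.
(* Runs of a single block agree. For longer runs both sides cut [p] into three pieces: the first
   block, the rest of the run, and the remainder. *)
rewrite [RHS]ssumD; congr (_ + _).
under [LHS]eq_ssum do rewrite bsum_ssum.
rewrite (ssumA p (fun Z Z' u u' v => bsum v (fun B => bsum u' (fun B' =>
  T (@pcons _ CH _ _ _ (b _ _ (@pcons _ CH _ _ _ (F u) (mapF B'))) (mapF B)))))).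
apply: eq_ssum => Z u v _; apply: eq_ssum => Z' u' v' _.
exact: exchange_big.
Qed.

(** In any blocking of a contracted path the contracted arrow lies in exactly one block, so the
    contraction can be performed inside that block; the sign of the arrows before it splits
    accordingly. *)
Lemma csum_bsum G X Y (p : npath H X Y) ds (T : paths C (f X) (f Y) -> M) :
  multilinear T ->
  csum G p ds (fun r => bsum r (fun B => T (mapF B))) =
  insum (fun X Y p ds => csum G p ds (F (Y := Y))) p ds T.
Proof.
elim/plen_ind: p ds T => {}X {}Y p IH ds T hT.
rewrite insum_rec (lin_csum _ _ _ _ (ml_one hT)).
under eq_csum do rewrite bsum_rec /=.
rewrite csumD csum_ssum; congr (_ + _); apply: eq_ssum => Z u v huv.
rewrite -IH; [|by case: (plen_split_lt huv)|exact: ml_tail].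
congr (_ + _); under [in RHS]eq_bsum do rewrite (lin_csum _ _ _ _ (ml_head _ hT)).
rewrite /csum /bsum exchange_big /=; apply: eq_bigr => d _.
by rewrite scaler_sumr.
Qed.

End Insertion.

(** * Homological perturbation *)

Section GradedVect.
Variables (K : fieldType) (V : gvect K).
Implicit Types x y : V.

Lemma gdegD r x y : gdeg r x -> gdeg r y -> gdeg r (x + y).
Proof. by move=> hx hy; rewrite -[x]scale1r; apply: gdegP. Qed.

Lemma gdegZ r k x : gdeg r x -> gdeg r (k *: x).
Proof. by move=> hx; rewrite -[k *: x]addr0; apply: gdegP => //; apply: gdeg0. Qed.

Lemma gdegN r x : gdeg r x -> gdeg r (- x).
Proof. by rewrite -scaleN1r; apply: gdegZ. Qed.

End GradedVect.

(** * Multilinearity and degrees of sums over cuts and blockings *)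

Section MultilinearSums.
Variables (K : fieldType) (Q : gquiver K).
Local Notation QH := (fun X Y => gsort (Mor Q X Y)).

Lemma lincomb_plen k X Y (p q r : paths Q X Y) :
  lincomb k p q r -> plen p = plen r /\ plen q = plen r.
Proof. by elim=> // {}X {}Y Z a {}p {}q {}r _ [/= -> ->]. Qed.

(** The one arrow that varies falls into exactly one of the two pieces of each cut. *)
Lemma ssum_multilinear (M : lmodType K) k X Y (p q r : paths Q X Y)
    (g : forall Z, paths Q X Z -> paths Q Z Y -> M) :
  lincomb k p q r ->
  (forall Z u u' u'' v, (plen u'' + plen v)%N = plen r -> lincomb k u u' u'' ->
     g Z u'' v = k *: g Z u v + g Z u' v) ->
  (forall Z u v v' v'', (plen u + plen v'')%N = plen r -> lincomb k v v' v'' ->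
     g Z u v'' = k *: g Z u v + g Z u v') ->
  ssum r g = k *: ssum p g + ssum q g.
Proof.
move=> h; elim: h g => {X Y p q r}
  [X Y a a' | X Y Z a a' p | X Y Z a p q r h IH] g g1 g2.
- by rewrite !ssum_one scaler0 addr0.
- rewrite !ssum_cons scalerDr addrACA ssumZ -ssumD; congr (_ + _).
    by apply: g1 => //; constructor.
  by apply: eq_ssum => W u v huv; apply: g1; [rewrite /= addSn huv | constructor].
rewrite !ssum_cons scalerDr addrACA; congr (_ + _); first exact: g2.
apply: (IH (fun Z u v => g Z (pcons a u) v)).
  by move=> W u u' u'' v huv hu; apply: g1; [rewrite /= addSn huv | constructor].
by move=> W u v v' v'' huv hv; apply: g2; rewrite // /= addSn huv.
Qed.

End MultilinearSums.

Section HomogeneousSums.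
Variables (K : fieldType) (Q : gquiver K).

Lemma pdeg_size X Y (p : paths Q X Y) ds : pdeg p ds -> size ds = plen p.
Proof.
elim: p ds => [{}X {}Y a | {}X {}Y Z a q IH] [|d ds] //=; first by case: ds.
by case=> _ /IH ->.
Qed.

Section Relation.
Variables (M N : zmodType) (R : M -> N -> Prop).
Hypothesis R0 : R 0 0.
Hypothesis RD : forall x y x' y', R x x' -> R y y' -> R (x + y) (x' + y').

(** Stated for a binary additive relation so as to serve twice: with equality as a congruence on
    homogeneous paths, and with a relation ignoring one side as a statement about degrees. *)
Lemma ssum_pdeg_ind X Y (p : paths Q X Y) ds g g' :
  pdeg p ds ->
  (forall Z u v, (plen u + plen v)%N = plen p -> pdeg u (take (plen u) ds) ->
     pdeg v (drop (plen u) ds) -> R (g Z u v) (g' Z u v)) ->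
  R (ssum p g) (ssum p g').
Proof.
elim: p ds g g' => [{}X {}Y a | {}X {}Y Z a q IH] [|d ds] g g' //.
  by move=> _ _; rewrite !ssum_one.
move=> /= [ha hq] h; rewrite !ssum_cons; apply: RD.
  by apply: h => //=; rewrite ?take0 ?drop0.
by apply: IH hq _ => W u v huv hu hv; apply: h => //=; rewrite addSn huv.
Qed.

End Relation.

Lemma eq_ssum_pdeg (M : zmodType) X Y (p : paths Q X Y) ds
    (g g' : forall Z, paths Q X Z -> paths Q Z Y -> M) :
  pdeg p ds ->
  (forall Z u v, (plen u + plen v)%N = plen p -> pdeg u (take (plen u) ds) ->
     pdeg v (drop (plen u) ds) -> g Z u v = g' Z u v) ->
  ssum p g = ssum p g'.
Proof. by apply: ssum_pdeg_ind => // x y x' y' -> ->. Qed.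

End HomogeneousSums.

Section BlockMaps.
Variables (K : fieldType) (D C : gquiver K) (f : ob D -> ob C).
Variable F : forall X Y, paths D X Y -> Mor C (f X) (f Y).
Local Notation CH := (fun X Y => gsort (Mor C X Y)).
Local Notation DH := (fun X Y => gsort (Mor D X Y)).
Local Notation mapF := (npmap (H := npath DH) (H' := CH) (f := f) F).

(** Bounded by length because [hpt_f] on a path is built from its values on strictly shorter
    ones. *)
Definition multilinear_upto (n : nat) : Prop := forall k X Y (p q r : paths D X Y),
  (plen r <= n)%N -> lincomb k p q r -> F r = k *: F p + F q.

Lemma bsum_multilinear n (M : lmodType K) k X Y (p q r : paths D X Y)
    (T : paths C (f X) (f Y) -> M) :
  multilinear_upto n -> multilinear T -> (plen r <= n)%N -> lincomb k p q r ->
  bsum r (fun B => T (mapF B)) =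
  k *: bsum p (fun B => T (mapF B)) + bsum q (fun B => T (mapF B)).
Proof.
move=> hF; elim/plen_ind: r p q T => {}X {}Y r IH p q T hT hn hl.
rewrite !bsum_rec scalerDr addrACA /= (hF _ _ _ _ _ _ hn hl) (ml_one hT).
congr (_ + _); apply: (ssum_multilinear hl).
  move=> Z u u' u'' v huv hu; rewrite bsumZ -bsumD; apply: eq_bsum => B.
  rewrite (hF _ _ _ _ _ _ _ hu) ?(ml_head _ hT) //.
  by apply: leq_trans hn; rewrite -huv leq_addr.
move=> Z u v v' v'' huv hv; have [lt_v _] := plen_split_lt huv.
rewrite (IH _ _ v'' lt_v v v' (fun P => T (@pcons _ CH _ _ _ (F u) P))) //.
  exact: ml_tail.
exact: leq_trans (ltnW lt_v) hn.
Qed.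

(** The analogue of [ssum_pdeg_ind] for blockings: as [F] has degree 0, the images of the blocks are
    homogeneous with the same total degree. *)
Lemma bsum_pdeg_ind (M N : zmodType) (R : M -> N -> Prop) n X Y
    (p : paths D X Y) ds T T' :
  R 0 0 -> (forall x y x' y', R x x' -> R y y' -> R (x + y) (x' + y')) ->
  (forall X Y (q : paths D X Y) es, (plen q <= n)%N -> pdeg q es ->
     sdeg (\sum_(d <- es) d) (F q)) ->
  (plen p <= n)%N -> pdeg p ds ->
  (forall B, pdeg (mapF B) (bdeg B ds) ->
     \sum_(d <- bdeg B ds) d = \sum_(d <- ds) d -> R (T B) (T' B)) ->
  R (bsum p T) (bsum p T').
Proof.
move=> R0 RD hF; elim/plen_ind: p ds T T' => {}X {}Y p IH ds T T' hn hp h.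
rewrite !bsum_rec; apply: (RD); first by apply: h => /=; rewrite ?big_seq1 //; apply: hF.
apply: (ssum_pdeg_ind R0 RD hp) => Z u v huv hu hv.
have [lt_v lt_u] := plen_split_lt huv.
apply: IH (lt_v) _ _ _ _ hv _ => [|B hB eB]; first exact: leq_trans (ltnW lt_v) hn.
apply: h => /=.
  by split=> //; apply: hF => //; apply: leq_trans (ltnW lt_u) hn.
by rewrite big_cons eB -big_cat cat_take_drop.
Qed.

Lemma eq_insum (M : lmodType K) G G' X Y (p : paths D X Y) ds
    (T : paths C (f X) (f Y) -> M) :
  (forall X' Y' (q : paths D X' Y') es, (plen q <= plen p)%N -> pdeg q es ->
     G X' Y' q es = G' X' Y' q es) ->
  pdeg p ds -> insum F G p ds T = insum F G' p ds T.
Proof.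
elim/plen_ind: p ds T => {}X {}Y p IH ds T hG hp.
rewrite !insum_rec hG //; congr (_ + _); apply: (eq_ssum_pdeg hp) => Z u v huv hu hv.
have [lt_v lt_u] := plen_split_lt huv.
rewrite hG ?(ltnW lt_u) // IH // => X' Y' q es hq.
by apply: hG; apply: leq_trans hq (ltnW lt_v).
Qed.

End BlockMaps.

(** * The transferred category and functor *)

Section Transfer.
Variables (K : fieldType) (C : ainf_pre K) (S : sdr_pre C).
Hypotheses (hC : is_ainf_cat C) (hS : is_sdr S).

Local Notation DQ := (ret_quiver S).
Local Notation CH := (fun X Y => gsort (Mor C X Y)).
Local Notation DH := (fun X Y => gsort (ret S X Y)).
Local Notation F := (@hpt_f K C S).
Local Notation G := (@hpt_b K C S).
Local Notation mapF := (npmap (H := npath DH) (H' := CH) (f := fun X : ob C => X) F).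
Local Notation sumF := (@hpt_sum K C S F _ _).
Local Notation blockF := (block_op (f := fun X : ob C => X) F (@bop K C)).

Let bop_ml X Y : multilinear (@bop K C X Y). Proof. by case: hC. Qed.
Let b1_linear X Y : linear (@b1 K C X Y). Proof. by move=> k x y; apply: bop_ml; constructor. Qed.

(** A blocking with at least two blocks is a first block and a blocking of a nonempty remainder,
    which removes the side condition on [plen B]. *)
Lemma hpt_sumE (G0 : forall X Y, paths DQ X Y -> Mor C X Y) X Y (p : paths DQ X Y) :
  hpt_sum G0 p = ssum p (fun Z u v => bsum v (fun B =>
    bop C (@pcons _ CH _ _ _ (G0 _ _ u)
      (npmap (H := npath DH) (H' := CH) (f := fun X : ob C => X) G0 B)))).
Proof.
rewrite /hpt_sum big_mkcond -/(bsum p _) bsum_rec /= add0r.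
apply: eq_ssum => Z u v _; apply: eq_bsum => B.
by rewrite ltnS plen_gt0.
Qed.

Lemma hpt_sum_one G0 X Y (x : ret S X Y) : hpt_sum G0 (@pone _ DH _ _ x) = 0.
Proof. by rewrite hpt_sumE ssum_one. Qed.

Lemma block_opE X Y (p : paths DQ X Y) : blockF p = b1 (F p) + sumF p.
Proof. by rewrite hpt_sumE /block_op bsum_rec. Qed.

(** Extension by zero to longer paths. It lets the base case and the recursive case of [hpt_f] and
    [hpt_b] be written as one formula, since [hpt_sum] vanishes on single arrows. *)
Definition on_arrow (W : lmodType K) X Y (L : ret S X Y -> W) (p : paths DQ X Y) : W :=
  match p in npath _ X Y return (ret S X Y -> W) -> W with
  | pone _ _ x => fun L => L x
  | pcons _ _ _ _ _ => fun=> 0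
  end L.

Lemma on_arrow_multilinear (W : lmodType K) X Y (L : ret S X Y -> W) :
  linear L -> multilinear (Q := DQ) (on_arrow L).
Proof.
move=> hL k p q r h; case: X Y p q r / h L hL => [X Y x y|X Y Z x y p|X Y Z x p q r _] L hL /=.
- exact: hL.
- by rewrite scaler0 addr0.
by rewrite scaler0 addr0.
Qed.

(** Only the contraction of the whole path leaves a single arrow. *)
Lemma csum_on_arrow (W : lmodType K) X Y (L : ret S X Y -> W) (p : paths DQ X Y) ds :
  csum G p ds (on_arrow L) = L (G p).
Proof.
case: p L => [{}X {}Y x | {}X {}Y Z x q] L; first by rewrite csum_one.
rewrite csum_cons csum0 scaler0 addr0 [X in _ + X]big1 ?addr0 //.
Qed.

Lemma hpt_fE X Y (p : paths DQ X Y) :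
  F p = on_arrow (@sdr_i K C S X Y) p - sdr_h S (sumF p).
Proof.
case: p => [{}X {}Y x | {}X {}Y Z x q]; last by rewrite hpt_f_cons sub0r.
by rewrite hpt_sum_one linear0 subr0.
Qed.

Lemma hpt_bE X Y (p : paths DQ X Y) :
  G p = on_arrow (@retd K C S X Y) p + sdr_p S (sumF p).
Proof.
case: p => [{}X {}Y x | {}X {}Y Z x q] /=; last by rewrite add0r.
by rewrite hpt_sum_one linear0 addr0.
Qed.

Lemma hpt_sum_multilinear n k X Y (p q r : paths DQ X Y) :
  multilinear_upto (D := DQ) F n -> (plen r <= n.+1)%N -> lincomb k p q r ->
  sumF r = k *: sumF p + sumF q.
Proof.
move=> hF hn hl; rewrite !hpt_sumE; apply: (ssum_multilinear hl).
  move=> Z u u' u'' v huv hu; rewrite bsumZ -bsumD; apply: eq_bsum => B.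
  rewrite (hF _ _ _ _ _ _ _ hu) ?(ml_head _ (@bop_ml X Y)) //.
  by have [_ lt_u] := plen_split_lt huv; rewrite -ltnS (leq_trans lt_u).
move=> Z u v v' v'' huv hv; have [lt_v _] := plen_split_lt huv.
apply: (bsum_multilinear (D := DQ) (C := C) (f := fun X : ob C => X)
  (T := fun P => bop C (@pcons _ CH _ _ _ (F u) P)) hF _ _ hv).
  exact: (@ml_tail _ _ _ _ _ _ _ (F u) (@bop_ml X Y)).
by rewrite -ltnS (leq_trans lt_v).
Qed.

Lemma hpt_f_multilinear_upto n : multilinear_upto (D := DQ) F n.
Proof.
elim: n => [|n IH] k X Y p q r hn hl; first by have := leq_trans (plen_gt0 r) hn.
rewrite !hpt_fE (hpt_sum_multilinear IH hn hl) linearP /=.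
rewrite (on_arrow_multilinear (@linearP _ _ _ _ _) hl).
by rewrite scalerBr opprD addrACA.
Qed.

Lemma hpt_f_multilinear X Y : multilinear (Q := DQ) (F (Y := Y) : paths DQ X Y -> _).
Proof. by move=> k p q r; apply: hpt_f_multilinear_upto. Qed.

Lemma retd_linear X Y : linear (@retd K C S X Y).
Proof. by move=> k x y; rewrite /retd linearP b1_linear linearP. Qed.

Lemma hpt_b_multilinear X Y : multilinear (Q := DQ) (G (Y := Y) : paths DQ X Y -> _).
Proof.
move=> k p q r hl; rewrite !hpt_bE.
rewrite (hpt_sum_multilinear (@hpt_f_multilinear_upto (plen r)) _ hl) //.
by rewrite (on_arrow_multilinear (@retd_linear _ _) hl) linearP /= scalerDr addrACA.
Qed.

Lemma hpt_sum_degree n X Y (p : paths DQ X Y) ds :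
  (forall X Y (q : paths DQ X Y) es, (plen q <= n)%N -> pdeg q es ->
     sdeg (\sum_(d <- es) d) (F q)) ->
  (plen p <= n.+1)%N -> pdeg p ds -> sdeg (\sum_(d <- ds) d + 1) (sumF p).
Proof.
move=> hF hn hp; rewrite hpt_sumE.
(* The second argument is a dummy; the induction principles compare two sums, and the other one is
   taken to be zero. *)
pose R (x _ : Mor C X Y) := sdeg (\sum_(d <- ds) d + 1) x.
have R0 : R 0 0 by apply: gdeg0.
have RD x y x' y' : R x x' -> R y y' -> R (x + y) (x' + y') by apply: gdegD.
apply: (ssum_pdeg_ind (R := R)
  (g' := fun Z u v => bsum v (fun=> 0)) R0 RD hp) => Z u v huv hu hv.
have [lt_v lt_u] := plen_split_lt huv.
apply: (@bsum_pdeg_ind _ DQ C (fun X : ob C => X) F _ _ R n _ _ v _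
  (fun B => bop C (@pcons _ CH _ _ _ (F u) (mapF B))) (fun=> 0) R0 RD hF _ hv).
  by rewrite -ltnS (leq_trans lt_v).
move=> B hB eB.
case: hC => _ hdeg _; rewrite /R.
have -> : \sum_(d <- ds) d =
    \sum_(d <- (\sum_(d <- take (plen u) ds) d) :: bdeg B (drop (plen u) ds)) d.
  by rewrite big_cons eB -big_cat cat_take_drop.
apply: hdeg; split=> //; apply: hF => //.
by rewrite -ltnS (leq_trans lt_u).
Qed.

Lemma hpt_f_degree X Y (p : paths DQ X Y) ds :
  pdeg p ds -> sdeg (\sum_(d <- ds) d) (F p).
Proof.
have [n] := ubnP (plen p).
elim: n X Y p ds => // n IH X Y p ds hn hp.
have [[hi _ hh] _ _ _ _] := hS X Y.
have hs : sdeg (\sum_(d <- ds) d + 1) (sumF p).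
  (* [hpt_sum] evaluates [hpt_f] on strictly shorter paths only, hence the bound [n.-1]; the case
     [n = 0] is empty since paths are nonempty. *)
  apply: (hpt_sum_degree (n := n.-1)) hp => [X' Y' q es hq|].
    by apply: IH; case: n hq {hn} => [|n] //; case: q.
  by case: n hn {IH} => // hn; case: p hn.
rewrite hpt_fE /sdeg; apply: gdegD; last first.
  by apply: gdegN; rewrite -[_ + 1](addrK 1); apply: hh.
case: p ds hp hi {hn hh hs} => [{}X {}Y x | {}X {}Y Z x q] [|d ds] //= hp hi.
  by case: ds hp => // hp; rewrite big_seq1; apply: hi.
exact: gdeg0.
Qed.

Lemma hpt_b_degree X Y : of_degree (Q := DQ) 1 (G (Y := Y) : paths DQ X Y -> _).
Proof.
move=> p ds hp; have [[_ hpi _] [hd _] _ _ _] := hS X Y.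
rewrite hpt_bE /sdeg; apply: gdegD; last first.
  apply: hpi; apply: (hpt_sum_degree (n := plen p)) hp => // X' Y' q es _.
  exact: hpt_f_degree.
case: p ds hp hd {hpi} => [{}X {}Y x | {}X {}Y Z x q] [|d ds] //= hp hd.
  by case: ds hp => // hp; rewrite big_seq1; apply: hd.
exact: gdeg0.
Qed.

Let b1b1 X Y (x : Mor C X Y) d : sdeg d x -> b1 (b1 x) = 0.
Proof.
case: hC => _ _ hrel hx; have := hrel _ _ (@pone _ CH X Y x) [:: d] hx.
by rewrite /= big_seq1 /= big_nil scale1r.
Qed.

(** The relations of [C] on the images of all blockings sum to zero. By [bsum_csum] this inserts
    [block_op] into one block; on proper blocks the functor equation replaces it by a contraction
    sum, and [csum_bsum] undoes the insertion. *)
Lemma b1_hpt_sum X Y (p : paths DQ X Y) ds :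
  pdeg p ds ->
  (forall X' Y' (q : paths DQ X' Y') es, (plen q < plen p)%N -> pdeg q es ->
     blockF q = csum G q es (F (Y := Y'))) ->
  b1 (sumF p) + csum G p ds (@hpt_sum K C S F _ _) = 0.
Proof.
move=> hp hlt.
have : bsum p (fun B => csum (@bop K C) (mapF B) (bdeg B ds) (@bop K C X Y)) = 0.
  rewrite -[RHS](_ : bsum p (fun=> 0) = 0); last exact: big1.
  apply: (@bsum_pdeg_ind _ DQ C (fun X : ob C => X) F _ _ eq (plen p) _ _ p ds
    _ (fun=> 0)) hp _ => //.
  - by move=> x y x' y' -> ->.
  - by move=> X' Y' q es _; apply: hpt_f_degree.
  by move=> B hB _; case: hC => _ _; apply.
rewrite (bsum_csum (f := fun X : ob C => X)) // insum_rec /=.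
set rest := ssum p _.
(* [csum_bsum] also produces the term in which the single block is all of [p], where the functor
   equation is not yet available; it is subtracted. *)
have -> : rest = csum G p ds (fun r => blockF r) -
    b1 (csum G p ds (F (Y := Y))).
  rewrite /block_op (csum_bsum (f := fun X : ob C => X)) // insum_rec /=.
  rewrite addrAC /b1 subrr add0r; apply: (eq_ssum_pdeg hp) => Z u v huv hu hv.
  have [lt_v lt_u] := plen_split_lt huv.
  rewrite (hlt _ _ u (take (plen u) ds)) //; congr (_ + _ *: _).
  apply: (@eq_insum _ DQ C (fun X : ob C => X) F _ _ _ _ _ v) => // X' Y' q es hq.
  by apply: hlt; apply: leq_ltn_trans hq lt_v.
under eq_csum do rewrite block_opE.
rewrite csumD (lin_csum _ _ _ _ (@b1_linear _ _)) -/(b1 _) block_opE (lin_add (@b1_linear _ _)).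
rewrite (b1b1 (hpt_f_degree hp)) add0r.
by rewrite addrAC subrr add0r.
Qed.

(** With S for [hpt_sum], inserting f = iota - h S into the right-hand side gives iota b^D - h (S
    b^D), that is iota b^D + h b_1 S by [b1_hpt_sum]. The homotopy identity turns this into b_1 f +
    S. *)
Lemma hpt_functor_eq X Y (p : paths DQ X Y) ds :
  pdeg p ds -> blockF p = csum G p ds (F (Y := Y)).
Proof.
elim/plen_ind: p ds => {}X {}Y p IH ds hp.
have hK := b1_hpt_sum hp (fun X' Y' q es hq hes => IH X' Y' q hq es hes).
under eq_csum do rewrite hpt_fE -scaleN1r.
rewrite csumD csum_on_arrow.
have hl : linear (fun x : Mor C X Y => -1 *: sdr_h S x).
  by move=> k x y; rewrite linearP !scaleN1r opprD scalerN.
rewrite -(lin_csum _ _ _ _ hl).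
have [_ _ [hi _] _ hh] := hS X Y.
have -> : csum G p ds (@hpt_sum K C S F X Y) = - b1 (sumF p).
  by apply/eqP; rewrite -addr_eq0 addrC hK.
rewrite scaleN1r linearN opprK block_opE hpt_fE hpt_bE linearD /=.
rewrite (lin_add (@b1_linear _ _)) (lin_opp (@b1_linear _ _)).
have -> : b1 (on_arrow (@sdr_i K C S X Y) p) = sdr_i S (on_arrow (@retd K C S X Y) p).
  case: p hi {IH hp hK hl hh} => [{}X {}Y x | {}X {}Y Z x q] hi /=; first exact: hi.
  by rewrite (lin0 (@b1_linear _ _)) linear0.
(* A summand b_1 h S is added and subtracted so that d h + h d appears. *)
rewrite -[sdr_h S (b1 _)](addKr (b1 (sdr_h S (sumF p)))) hh -!addrA.
by congr (_ + _); rewrite addrCA [sdr_i S _ + _]addrC subrK.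
Qed.

(** The relation on [p] is d^D b^D + pi (S b^D) = d^D b^D - pi b_1 S. As pi is a chain map, only d^D
    d^D on single arrows survives. *)
Lemma hpt_is_ainf_cat : is_ainf_cat (hpt_cat S).
Proof.
split=> [X Y | X Y | X Y p ds hp]; first exact: hpt_b_multilinear.
  exact: hpt_b_degree.
have hK : csum G p ds (@hpt_sum K C S F X Y) = - b1 (sumF p).
  apply/eqP; rewrite -addr_eq0 addrC; apply/eqP.
  by apply: b1_hpt_sum hp _ => X' Y' q es _; apply: hpt_functor_eq.
rewrite -/(csum G p ds (G (Y := Y))).
under eq_csum do rewrite hpt_bE.
rewrite csumD csum_on_arrow.
have hl : linear (@sdr_p K C S X Y) by move=> k x y; rewrite linearP.
rewrite -(lin_csum _ _ _ _ hl) hK linearN.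
have [_ [_ hdd] [_ hpd] _ _] := hS X Y.
rewrite hpt_bE (lin_add (@retd_linear _ _)) hpd addrK.
case: p hdd {hp hK hpd hl} => [{}X {}Y x | {}X {}Y Z x q] hdd /=; first exact: hdd.
exact: lin0 (@retd_linear _ _).
Qed.

Lemma hpt_is_ainf_qiso : is_ainf_qiso (hpt_functor S).
Proof.
split; first split=> [X Y | X Y p ds hp | X Y p ds hp].
- exact: hpt_f_multilinear.
- by rewrite addr0; apply: hpt_f_degree.
- exact: hpt_functor_eq hp.
- by exists id.
move=> X Y; have [_ _ [hi hp] hpi hh] := hS X Y; split.
- by move=> x hx; rewrite /cocycle hi [retd x]hx linear0.
- by move=> x y [z hz]; exists (sdr_i S z); rewrite hi -linearB /= hz.
- move=> x y _ _ [z hz]; exists (sdr_p S z).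
  by rewrite [RHS]hp -hz linearB /= !hpi.
move=> c hc; exists (sdr_p S c).
  by rewrite /cocycle [LHS]hp hc linear0.
(* On a cocycle the homotopy identity reads b_1 h c = c - iota pi c. *)
exists (- sdr_h S c); rewrite (lin_opp (@b1_linear _ _)).
by have := hh c; rewrite hc linear0 addr0 => ->; rewrite opprB.
Qed.

End Transfer.

(** * Additive enlargements *)

Lemma koszul_even (K : fieldType) (k m n : int) :
  m = n + (k + k) -> koszul K m = koszul K n.
Proof. by move=> ->; rewrite !koszulD koszulK mulr1. Qed.

Section Signs.
Implicit Types (a : enl_kind) (rs : seq int).

Lemma sum_head_behead rs : \sum_(r <- rs) r = head 0 rs + \sum_(r <- behead rs) r.
Proof. by case: rs => [|r rs]; rewrite /= ?big_cons ?big_nil ?addr0. Qed.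

(** The source shift is the sign of both the enlarged homotopy and the enlarged b_1; combined with
    the sign of an operation it gives the sign of the induced functor. *)
Lemma koszul_enl_sign (K : fieldType) a rs :
  koszul K (head 0 rs + enl_b_sign a rs) = koszul K (enl_f_sign a rs).
Proof.
apply: (@koszul_even K (head 0 rs)); case: a; rewrite /= ?add0r //.
by rewrite sum_head_behead; ring.
Qed.

End Signs.

(** * Threads of matrix entries *)

Section Threads.
Variables (K : fieldType) (Q : gquiver K).
Local Notation EQ := (enl_quiver (Mor Q)).
Local Notation QH := (fun X Y => gsort (Mor Q X Y)).
Local Notation EH := (fun X Y => gsort (enl_hom (Mor Q) X Y)).

Definition tsum (M : zmodType) (X Y : fsum (ob Q)) (P : paths EQ X Y) i j
    (T : seq int -> paths Q (fs_ob X i) (fs_ob Y j) -> M) : M :=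
  \sum_(t <- threads P i j) T t.1 t.2.

(* The degrees of the entries along a thread, ds being those of the matrices,
   rs the shifts of the sources and e the last shift. *)
Fixpoint tdeg (ds rs : seq int) (e : int) : seq int :=
  if rs is r :: rs' then head 0 ds + (head e rs' - r) :: tdeg (behead ds) rs' e
  else [::].

(** The differences of consecutive shifts telescope. *)
Lemma sum_tdeg ds rs e : size ds = size rs ->
  \sum_(d <- tdeg ds rs e) d = \sum_(d <- ds) d + (e - head e rs).
Proof.
elim: rs ds => [|r rs IH] [|d ds] //=; first by rewrite subrr !big_nil.
by case=> /IH e'; rewrite !big_cons e'; ring.
Qed.

Section Zmod.
Variable M : zmodType.

Lemma tsum_one (X Y : fsum (ob Q)) (A : enl_hom (Mor Q) X Y) i j
    (T : seq int -> paths Q (fs_ob X i) (fs_ob Y j) -> M) :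
  tsum (@pone _ EH _ _ A) T = T [:: fs_sh X i] (@pone _ QH _ _ (mxentry A i j)).
Proof. exact: big_seq1. Qed.

Lemma tsum_cons (X Y Z : fsum (ob Q)) (A : enl_hom (Mor Q) X Y) (P : paths EQ Y Z) i j
    (T : seq int -> paths Q (fs_ob X i) (fs_ob Z j) -> M) :
  tsum (@pcons _ EH _ _ _ A P) T =
  \sum_m tsum P (fun rs p =>
    T (fs_sh X i :: rs) (@pcons _ QH _ (fs_ob Y m) _ (mxentry A i m) p)).
Proof.
rewrite /tsum /= big_flatten big_map big_enum.
by apply: eq_bigr => m _; rewrite big_map.
Qed.

Lemma exchange_tsum (X Y X' Y' : fsum (ob Q)) (P : paths EQ X Y) (P' : paths EQ X' Y')
    i j i' j' (T : seq int -> paths Q (fs_ob X i) (fs_ob Y j) ->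
                   seq int -> paths Q (fs_ob X' i') (fs_ob Y' j') -> M) :
  tsum P (fun rs p => tsum P' (T rs p)) =
  tsum P' (fun rs' p' => tsum P (fun rs p => T rs p rs' p')).
Proof. exact: exchange_big. Qed.

Lemma tsum0 (X Y : fsum (ob Q)) (P : paths EQ X Y) i j :
  tsum P (fun (_ : seq int) (_ : paths Q (fs_ob X i) (fs_ob Y j)) => 0) = 0 :> M.
Proof. exact: big1. Qed.

Lemma tsumD (X Y : fsum (ob Q)) (P : paths EQ X Y) i j
    (T T' : seq int -> paths Q (fs_ob X i) (fs_ob Y j) -> M) :
  tsum P (fun rs p => T rs p + T' rs p) = tsum P T + tsum P T'.
Proof. exact: big_split. Qed.

End Zmod.

Lemma tsum_ind (M N : zmodType) (R : M -> N -> Prop) (X Y : fsum (ob Q))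
    (P : paths EQ X Y) i j T T' :
  R 0 0 -> (forall x y x' y', R x x' -> R y y' -> R (x + y) (x' + y')) ->
  (forall rs (p : paths Q (fs_ob X i) (fs_ob Y j)),
     head 0 rs = fs_sh X i -> size rs = plen p -> plen p = plen P ->
     (forall ds, pdeg P ds -> pdeg p (tdeg ds rs (fs_sh Y j))) ->
     R (T rs p) (T' rs p)) ->
  R (tsum P T) (tsum P T').
Proof.
move=> R0 RD; elim: P i j T T' => [{}X {}Y A | {}X {}Y Z A P IH] i j T T' h.
  rewrite !tsum_one; apply: h => //= -[|d [|d' ds]] //= hA.
  by have := hA (i, j); rewrite /sdeg /= addrAC.
rewrite !tsum_cons; apply: (big_ind2 R) => [||m _]; [exact: R0|by move=> x x' y y'; apply: RD|].
apply: IH => rs p h1 h2 h3 h4.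
apply: h => //=; first by rewrite h2.
  by rewrite h3.
case=> [|d ds] //= [hA /h4 hp]; split=> //.
have := hA (i, m); rewrite /sdeg /= addrAC.
by have := plen_gt0 p; rewrite -h2; case: rs h1 {h2 h4 hp} => [|r rs] //= ->.
Qed.

Lemma eq_tsum (M : zmodType) (X Y : fsum (ob Q)) (P : paths EQ X Y) i j
    (T T' : seq int -> paths Q (fs_ob X i) (fs_ob Y j) -> M) :
  (forall rs p, head 0 rs = fs_sh X i -> size rs = plen p -> plen p = plen P ->
     T rs p = T' rs p) ->
  tsum P T = tsum P T'.
Proof.
by move=> h; apply: tsum_ind => // [x y x' y' -> -> //|rs p h1 h2 h3 _]; apply: h.
Qed.

Lemma tsumZ (M : lmodType K) k (X Y : fsum (ob Q)) (P : paths EQ X Y) i j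
    (T : seq int -> paths Q (fs_ob X i) (fs_ob Y j) -> M) :
  k *: tsum P T = tsum P (fun rs p => k *: T rs p).
Proof. exact: scaler_sumr. Qed.

Lemma lin_tsum (M N : lmodType K) (L : M -> N) (X Y : fsum (ob Q))
    (P : paths EQ X Y) i j (T : seq int -> paths Q (fs_ob X i) (fs_ob Y j) -> M) :
  linear L -> L (tsum P T) = tsum P (fun rs p => L (T rs p)).
Proof. by move=> hL; apply: lin_sum. Qed.

Lemma tsum_multilinear (M : lmodType K) k (X Y : fsum (ob Q)) (P P' R : paths EQ X Y) i j
    (T : seq int -> paths Q (fs_ob X i) (fs_ob Y j) -> M) :
  lincomb k P P' R -> (forall rs, multilinear (T rs)) ->
  tsum R T = k *: tsum P T + tsum P' T.
Proof.
move=> h; elim: h i j T => {X Y P P' R}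
  [X Y A A' | X Y Z A A' P | X Y Z A P P' R h IH] i j T hT.
- by rewrite !tsum_one /mxentry linearP (ml_one (hT _)).
- rewrite !tsum_cons scaler_sumr -big_split; apply: eq_bigr => m _ /=.
  rewrite tsumZ -tsumD; apply: eq_tsum => rs p _ _ _.
  by rewrite /mxentry linearP (ml_head _ (hT _)).
rewrite !tsum_cons scaler_sumr -big_split; apply: eq_bigr => m _ /=.
by apply: IH => rs; apply: ml_tail.
Qed.

(** Cutting a thread means cutting the sequence of matrices, choosing the summand [m] at the cut,
    and threading both pieces; the list of shifts is cut at the same place. *)
Lemma tsum_ssum (M : zmodType) (X Y : fsum (ob Q)) (P : paths EQ X Y) i j
    (g : forall Z, seq int -> paths Q (fs_ob X i) Z ->
                   seq int -> paths Q Z (fs_ob Y j) -> M) :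
  tsum P (fun rs p => ssum p (fun Z u v =>
    g Z (take (plen u) rs) u (drop (plen u) rs) v)) =
  ssum P (fun Z P1 P2 => \sum_m tsum P1 (fun rs1 u => tsum P2 (fun rs2 v =>
    g (fs_ob Z m) rs1 u rs2 v))).
Proof.
elim: P i j g => [{}X {}Y A | {}X {}Y Z A P IH] i j g.
  by rewrite tsum_one !ssum_one.
rewrite tsum_cons ssum_cons.
transitivity (\sum_m (tsum P (fun rs p =>
    g _ [:: fs_sh X i] (@pone _ QH _ _ (mxentry A i m)) rs p) +
  tsum P (fun rs p => ssum p (fun Z' u v => g Z' (fs_sh X i :: take (plen u) rs)
    (@pcons _ QH _ _ _ (mxentry A i m) u) (drop (plen u) rs) v)))).
  apply: eq_bigr => m _; rewrite -tsumD; apply: eq_tsum => rs p _ _ _.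
  by rewrite ssum_cons /= take0 drop0.
rewrite big_split /=; congr (_ + _).
  by apply: eq_bigr => m _; rewrite tsum_one.
under eq_bigr => m _.
  rewrite (IH m j (fun Z' rs1 u rs2 v => g Z' (fs_sh X i :: rs1)
    (@pcons _ QH _ _ _ (mxentry A i m) u) rs2 v)).
  over.
rewrite /ssum exchange_big /=; apply: eq_bigr => d _.
by rewrite exchange_big; apply: eq_bigr => m _; rewrite tsum_cons.
Qed.

End Threads.

(** * The A-infinity relations of the enlargement *)

Section EnlargedOperations.
Variables (K : fieldType) (a : enl_kind) (C : ainf_pre K).
Hypothesis hC : is_ainf_cat C.
Local Notation CH := (fun X Y => gsort (Mor C X Y)).
Local Notation EH := (fun X Y => gsort (enl_hom (Mor C) X Y)).
Local Notation EQ := (enl_quiver (Mor C)).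

Lemma entry_enl_b (X Y : fsum (ob C)) (P : paths EQ X Y) i j :
  mxentry (enl_b a P) i j =
  tsum P (fun rs (p : paths C (fs_ob X i) (fs_ob Y j)) =>
    koszul K (enl_b_sign a rs) *: bop C p).
Proof. by rewrite /mxentry dprodE. Qed.

Lemma enl_b_sign_one r : enl_b_sign a [:: r] = r.
Proof. by case: a; rewrite //= big_seq1. Qed.

(* The signs of the enlarged operations differ from those forced by the degree
   shifts of the entries by a factor that only depends on the thread. *)
Lemma csum_tsum (M : lmodType K) (X Y : fsum (ob C)) (P : paths EQ X Y) ds i j
    (T : paths C (fs_ob X i) (fs_ob Y j) -> M) :
  multilinear T ->
  csum (@enl_b K a C) P ds (fun R : paths EQ X Y =>
    tsum R (fun rs p => koszul K (enl_b_sign a rs) *: T p)) =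
  tsum P (fun rs p =>
    koszul K (enl_f_sign a rs) *: csum (@bop K C) p (tdeg ds rs (fs_sh Y j)) T).
Proof.
(* Contraction of the whole sequence. *)
have full (X' Y' : fsum (ob C)) (R : paths EQ X' Y') i' j'
    (T' : paths C (fs_ob X' i') (fs_ob Y' j') -> M) :
    multilinear T' ->
    tsum (@pone _ EH _ _ (enl_b a R)) (fun rs p => koszul K (enl_b_sign a rs) *: T' p) =
    tsum R (fun rs p => koszul K (enl_f_sign a rs) *: T' (@pone _ CH _ _ (bop C p))).
  move=> hT'; rewrite tsum_one entry_enl_b (lin_tsum _ _ (ml_one hT')) tsumZ.
  apply: eq_tsum => rs p e _ _.
  by rewrite (lin_scale (ml_one hT')) scalerA -koszulD enl_b_sign_one -e koszul_enl_sign.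
elim: P ds i j T => [{}X {}Y A | {}X {}Y Z A P IH] ds i j T hT.
  by rewrite csum_one full // !tsum_one csum_one.
rewrite csum_cons full //.
(* Contraction of a proper initial segment. Below, the shifts are written as a concatenation so that
   [tsum_ssum] can cut them. *)
have split_part : ssum (@pcons _ EH _ _ _ A P) (fun W P1 P2 =>
      tsum (@pcons _ EH _ _ _ (enl_b a P1) P2)
        (fun rs p => koszul K (enl_b_sign a rs) *: T p)) =
    tsum (@pcons _ EH _ _ _ A P) (fun rs p => koszul K (enl_f_sign a rs) *:
      ssum p (fun W u v => T (@pcons _ CH _ _ _ (bop C u) v))).
  transitivity (tsum (@pcons _ EH _ _ _ A P) (fun rs p => ssum p (fun W u v =>
      koszul K (enl_f_sign a (take (plen u) rs ++ drop (plen u) rs)) *: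
        T (@pcons _ CH _ _ _ (bop C u) v)))); last first.
    by apply: eq_tsum => rs p _ _ _; rewrite ssumZ; apply: eq_ssum => W u v _;
       rewrite cat_take_drop.
  rewrite (tsum_ssum _ (fun W rs1 u rs2 v => koszul K (enl_f_sign a (rs1 ++ rs2)) *:
        T (@pcons _ CH _ _ _ (bop C u) v))).
  apply: eq_ssum => W P1 P2 _; rewrite tsum_cons; apply: eq_bigr => m _.
  rewrite entry_enl_b; under eq_tsum => rs p _ _ _.
    rewrite (lin_tsum _ _ (ml_head _ hT)) tsumZ; over.
  rewrite [LHS]exchange_tsum.
  apply: eq_tsum => rs1 u e1 s1 _; apply: eq_tsum => rs2 v _ _ _.
  rewrite (lin_scale (ml_head _ hT)) scalerA -koszulD; congr (_ *: _).
  case: rs1 e1 s1 => [|r rs1] /= e1 s1; first by case: u s1.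
  (* The source shift [r] occurs once in the inner and once in the outer operation, so it cancels
     modulo 2. *)
  apply: (@koszul_even K r); rewrite e1; case: (a) => /=; first by ring.
  by rewrite !big_cons big_cat /=; ring.
have tail_part : koszul K (head 0 ds) *: csum (@enl_b K a C) P (behead ds)
      (fun R => tsum (@pcons _ EH _ _ _ A R)
        (fun rs p => koszul K (enl_b_sign a rs) *: T p)) =
    \sum_m tsum P (fun rs p => koszul K (enl_f_sign a (fs_sh X i :: rs)) *:
      (koszul K (head 0 ds + (head (fs_sh Z j) rs - fs_sh X i)) *:
        csum (@bop K C) p (tdeg (behead ds) rs (fs_sh Z j))
          (fun q => T (@pcons _ CH _ _ _ (mxentry A i m) q)))).
  under eq_csum do rewrite tsum_cons.
  rewrite csum_sum scaler_sumr; apply: eq_bigr => m _.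
  (* The change of the operation sign when the arrow from summand [i] to [m] is put in front; it is
     the same for all threads starting at [m], so it leaves the contraction sum. *)
  pose c := if a is Enl1 then fs_sh X i - fs_sh Y m else fs_sh X i.
  have shift (R : paths EQ Y Z) : tsum R (fun rs p =>
        koszul K (enl_b_sign a (fs_sh X i :: rs)) *:
          T (@pcons _ CH _ _ _ (mxentry A i m) p)) =
      koszul K c *: tsum R (fun rs p => koszul K (enl_b_sign a rs) *:
          T (@pcons _ CH _ _ _ (mxentry A i m) p)).
    rewrite tsumZ; apply: eq_tsum => rs p e _ _.
    rewrite scalerA -koszulD /c; case: (a) => /=; first by rewrite e subrK.
    by rewrite big_cons.
  under eq_csum do rewrite shift.
  rewrite csumZ (IH (behead ds) m j _ (ml_tail _ hT)) scalerA tsumZ.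
  apply: eq_tsum => rs p e s _; rewrite !scalerA -!koszulD; congr (_ *: _).
  case: rs e s => [|r rs] /= e s; first by case: p s.
  (* The entry of [A] has degree shifted by the difference of these two shifts, which accounts for
     [c] modulo 2. *)
  apply: (@koszul_even K (fs_sh X i - fs_sh Y m)); rewrite e /c.
  by case: (a) => /=; rewrite ?big_cons ?e; ring.
rewrite split_part tail_part -tsumD !tsum_cons -big_split; apply: eq_bigr => m _ /=.
by rewrite -tsumD; apply: eq_tsum => rs p _ _ _; rewrite csum_cons /= !scalerDr.
Qed.

Lemma enl_is_ainf_cat : is_ainf_cat (enl a C).
Proof.
have [hml hdeg hrel] := hC; split=> [X Y | X Y P ds hP | X Y P ds hP].
- move=> k P P' R hR; apply/dprodP=> -[i j].
  rewrite linearP /= -!/(mxentry _ i j) !entry_enl_b.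
  apply: tsum_multilinear hR _ => rs k' p q r h.
  by rewrite (hml _ _ _ _ _ _ h) scalerDr !scalerA mulrC.
- move=> [i j]; rewrite -/(mxentry _ i j) entry_enl_b /=.
  pose R (x _ : Mor C (fs_ob X i) (fs_ob Y j)) :=
    gdeg (\sum_(d <- ds) d + 1 + 1 + (fs_sh Y j - fs_sh X i)) x.
  apply: (@tsum_ind _ _ _ _ R _ _ P i j _ (fun _ _ => 0)).
  + exact: gdeg0.
  + by move=> x y x' y'; apply: gdegD.
  move=> rs p e s s' /(_ _ hP) hp; apply: gdegZ.
  have := hdeg _ _ _ _ hp; rewrite /sdeg sum_tdeg ?s ?(pdeg_size hP) //.
  suff -> : head (fs_sh Y j) rs = fs_sh X i.
    by congr gdeg; ring.
  by case: rs e s {hp} => [|r rs] //=; case: p s'.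
rewrite -/(csum (@enl_b K a C) P ds (@enl_b K a C X Y)).
apply/dprodP=> -[i j]; rewrite linear0 (lin_csum _ _ _ _ (@linearP _ _ _ _ (entry (i, j)))).
rewrite (eq_csum _ _ _ (fun R => entry_enl_b R i j)).
rewrite csum_tsum //.
rewrite -[RHS](tsum0 _ P i j); apply: tsum_ind => // [x y x' y' -> -> //|rs p _ _ _ hp].
by rewrite [csum _ _ _ _]hrel ?scaler0 //; apply: hp.
Qed.

End EnlargedOperations.

(** * The induced retract data *)

Section EnlargedRetract.
Variables (K : fieldType) (a : enl_kind) (C : ainf_pre K) (S : sdr_pre C).
Hypotheses (hC : is_ainf_cat C) (hS : is_sdr S).
Local Notation CH := (fun X Y => gsort (Mor C X Y)).

Lemma entry_enl_b1 (X Y : fsum (ob C)) (A : enl_hom (Mor C) X Y) i j :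
  mxentry (b1 (C := enl a C) A) i j = koszul K (fs_sh X i) *: b1 (mxentry A i j).
Proof. by rewrite /b1 /= entry_enl_b tsum_one enl_b_sign_one. Qed.

Lemma entry_enl_sdr_i (X Y : fsum (ob C)) (A : enl_hom (ret S) X Y) i j :
  mxentry (sdr_i (enl_sdr a S) A) i j = sdr_i S (mxentry A i j).
Proof. by rewrite /mxentry dprodE scale1r. Qed.

Lemma entry_enl_sdr_p (X Y : fsum (ob C)) (A : enl_hom (Mor C) X Y) i j :
  mxentry (sdr_p (enl_sdr a S) A) i j = sdr_p S (mxentry A i j).
Proof. by rewrite /mxentry dprodE scale1r. Qed.

Lemma entry_enl_sdr_h (X Y : fsum (ob C)) (A : enl_hom (Mor C) X Y) i j :
  mxentry (sdr_h (enl_sdr a S) A) i j = koszul K (fs_sh X i) *: sdr_h S (mxentry A i j).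
Proof. by rewrite /mxentry dprodE. Qed.

Lemma entry_enl_retd (X Y : fsum (ob C)) (A : enl_hom (ret S) X Y) i j :
  mxentry (retd (S := enl_sdr a S) A) i j =
  koszul K (fs_sh X i) *: retd (mxentry A i j).
Proof.
by rewrite /retd entry_enl_sdr_p entry_enl_b1 linearZ /= entry_enl_sdr_i.
Qed.

Lemma mxentryP (H : ob C -> ob C -> gvect K) (X Y : fsum (ob C)) (A B : enl_hom H X Y) :
  (forall i j, mxentry A i j = mxentry B i j) -> A = B.
Proof. by move=> e; apply/dprodP=> -[i j]; apply: e. Qed.

(** The enlarged differential and homotopy carry the same sign on each entry, so it squares to 1 in
    d h + h d. *)
Lemma enl_sdr_is_sdr : is_sdr (enl_sdr a S).
Proof.
have b1_linear X Y : linear (@b1 K C X Y).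
  by move=> k x y; case: hC => h _ _; apply: h; constructor.
move=> X Y; split.
- split=> r A hA [i j]; have [[hi hp hh] _ _ _ _] := hS (fs_ob X i) (fs_ob Y j);
    rewrite dprodE; apply: gdegZ.
  + exact: hi (hA (i, j)).
  + exact: hp (hA (i, j)).
  by rewrite addrAC; apply: hh (hA (i, j)).
- split=> [r A hA [i j] | A].
    have [_ [hd _] _ _ _] := hS (fs_ob X i) (fs_ob Y j).
    rewrite -/(mxentry _ i j) entry_enl_retd addrAC.
    by apply: gdegZ; apply: hd (hA (i, j)).
  apply: mxentryP => i j; have [_ [_ hdd] _ _ _] := hS (fs_ob X i) (fs_ob Y j).
  rewrite !entry_enl_retd (lin_scale (@retd_linear _ _ S hC _ _)) hdd !scaler0.
  by rewrite /mxentry linear0.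
- split=> A; apply: mxentryP => i j;
    have [_ _ [hi hp] _ _] := hS (fs_ob X i) (fs_ob Y j).
    by rewrite entry_enl_b1 !entry_enl_sdr_i entry_enl_retd linearZ /= hi.
  by rewrite entry_enl_retd !entry_enl_sdr_p hp entry_enl_b1 linearZ.
- move=> A; apply: mxentryP => i j; rewrite entry_enl_sdr_p entry_enl_sdr_i.
  by have [_ _ _ -> _] := hS (fs_ob X i) (fs_ob Y j).
move=> A; apply: mxentryP => i j.
have [_ _ _ _ hh] := hS (fs_ob X i) (fs_ob Y j).
rewrite /mxentry linearD linearB /= -!/(mxentry _ i j).
rewrite entry_enl_b1 !entry_enl_sdr_h entry_enl_b1 entry_enl_sdr_i entry_enl_sdr_p.
by rewrite linearZ (lin_scale (@b1_linear _ _)) /= !scalerA koszulK !scale1r hh.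
Qed.

End EnlargedRetract.

(** * Perturbation commutes with enlargement *)

Lemma eq_bsum_npmap (M : zmodType) (O O' : Type) (H : O -> O -> Type)
    (H' : O' -> O' -> Type) (f : O -> O')
    (F F' : forall X Y, npath H X Y -> H' (f X) (f Y)) X Y (p : npath H X Y)
    (T : npath H' (f X) (f Y) -> M) :
  (forall X' Y' (q : npath H X' Y'), (plen q <= plen p)%N -> F X' Y' q = F' X' Y' q) ->
  bsum p (fun B => T (npmap F B)) = bsum p (fun B => T (npmap F' B)).
Proof.
elim/plen_ind: p T => {}X {}Y p IH T hF; rewrite !bsum_rec /= hF //.
congr (_ + _); apply: eq_ssum => Z u v huv; have [lt_v lt_u] := plen_split_lt huv.
rewrite hF ?(ltnW lt_u) //.
apply: (IH _ _ v lt_v (fun P => T (pcons (F' X Z u) P))) => X' Y' q hq.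
by apply: hF; apply: leq_trans hq (ltnW lt_v).
Qed.

(** * Signs of blocked threads *)

Section BlockShifts.
Variables (O : Type) (H : O -> O -> Type) (a : enl_kind).

Fixpoint block_shifts X Y (B : npath (npath H) X Y) (rs : seq int) : seq int :=
  match B with
  | pone _ _ u => [:: head 0 rs]
  | pcons _ _ _ u B' => head 0 rs :: block_shifts B' (drop (plen u) rs)
  end.

Fixpoint block_sign X Y (B : npath (npath H) X Y) (rs : seq int) : int :=
  match B with
  | pone _ _ u => enl_f_sign a rs
  | pcons _ _ _ u B' =>
      enl_f_sign a (take (plen u) rs) + block_sign B' (drop (plen u) rs)
  end.

(** For a = 2 the functor sign of a block omits its first shift, and the outer operation supplies
    exactly these. For a = 1 the functor signs vanish and the outer operation sees the first
    shift. *)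
Lemma block_sign_shifts X Y (B : npath (npath H) X Y) rs :
  block_sign B rs + enl_b_sign a (block_shifts B rs) = enl_b_sign a rs.
Proof.
elim: B rs => [{}X {}Y u | {}X {}Y Z u B IH] rs /=.
  case: a => /=; first by rewrite add0r.
  by rewrite big_seq1 [RHS]sum_head_behead addrC.
case: a IH => /= IH.
  suff -> : block_sign B (drop (plen u) rs) = 0 by rewrite !add0r.
  move: (drop (plen u) rs) => rs'.
  have e : head 0 (block_shifts B rs') = head 0 rs' by case: (B).
  by apply: (addIr (head 0 rs')); rewrite add0r -{1}e IH.
have := IH (drop (plen u) rs); rewrite big_cons.
have -> : \sum_(r <- rs) r =
    \sum_(r <- take (plen u) rs) r + \sum_(r <- drop (plen u) rs) r.
  by rewrite -big_cat cat_take_drop.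
move=> /= <-; rewrite [\sum_(r <- take _ _) r]sum_head_behead.
have -> : head 0 (take (plen u) rs) = head 0 rs.
  by case: (plen u) (plen_gt0 u) rs => // n _ [].
by ring.
Qed.

End BlockShifts.

Section EnlargedTransfer.
Variables (K : fieldType) (a : enl_kind) (C : ainf_pre K) (S : sdr_pre C).
Hypothesis hC : is_ainf_cat C.

Local Notation DQ := (ret_quiver S).
Local Notation EQ := (enl_quiver (Mor DQ)).
Local Notation CH := (fun X Y => gsort (Mor C X Y)).
Local Notation DH := (fun X Y => gsort (ret S X Y)).
Local Notation ECH := (fun X Y => gsort (enl_hom (Mor C) X Y)).
Local Notation EDH := (fun X Y => gsort (enl_hom (ret S) X Y)).
Local Notation mapD F :=
  (npmap (H := npath DH) (H' := CH) (f := fun X : ob C => X) F).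
Local Notation mapE F :=
  (npmap (H := npath EDH) (H' := ECH) (f := fun X : fsum (ob C) => X) F).

Section Family.
Variable F : forall X Y : ob C, paths DQ X Y -> Mor C X Y.

Definition enl_family (X Y : fsum (ob C)) (P : paths EQ X Y) : enl_hom (Mor C) X Y :=
  dprod_of (fun ij => tsum P (fun rs (p : paths DQ (fs_ob X ij.1) (fs_ob Y ij.2)) =>
    koszul K (enl_f_sign a rs) *: (F p : gsort _))).

Lemma entry_enl_family (X Y : fsum (ob C)) (P : paths EQ X Y) i j :
  mxentry (enl_family P) i j =
  tsum P (fun rs (p : paths DQ (fs_ob X i) (fs_ob Y j)) =>
    koszul K (enl_f_sign a rs) *: (F p : gsort _)).
Proof. by rewrite /mxentry dprodE. Qed.

(** Blocking matrices and then threading their images agrees with threading first and blocking each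
    thread; the functor signs of the blocks add up to [block_sign]. *)
Lemma bsum_tsum (M : lmodType K) (X Y : fsum (ob C)) (P : paths EQ X Y) i j
    (T : seq int -> paths C (fs_ob X i) (fs_ob Y j) -> M) :
  (forall rs, multilinear (T rs)) ->
  bsum P (fun B => tsum (mapE enl_family B) T) =
  tsum (Q := DQ) P (fun rs (p : paths DQ (fs_ob X i) (fs_ob Y j)) => bsum p (fun B =>
    koszul K (block_sign a B rs) *: T (block_shifts B rs) (mapD F B))).
Proof.
elim/plen_ind: P i j T => {}X {}Y P IH i j T hT.
rewrite bsum_rec.
under [RHS]eq_tsum do rewrite bsum_rec.
rewrite tsumD; congr (_ + _).
  rewrite tsum_one entry_enl_family (lin_tsum _ _ (ml_one (hT _))).
  by apply: eq_tsum => rs p e _ _; rewrite (lin_scale (ml_one (hT _))) /= e.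
transitivity (tsum (Q := DQ) P (fun rs (p : paths DQ (fs_ob X i) (fs_ob Y j)) =>
    ssum p (fun Z u v => bsum v (fun B =>
      koszul K (enl_f_sign a (take (plen u) rs) + block_sign a B (drop (plen u) rs)) *:
      T (head 0 (take (plen u) rs) :: block_shifts B (drop (plen u) rs))
        (@pcons _ CH _ _ _ (F u) (mapD F B)))))); last first.
  apply: eq_tsum => rs p e _ _; apply: eq_ssum => Z u v _; apply: eq_bsum => B /=.
  suff -> : head 0 (take (plen u) rs) = head 0 rs by [].
  by case: (plen u) (plen_gt0 u) (rs) => // n _ [].
rewrite (tsum_ssum (Q := DQ) _ (fun Z rs1 u rs2 v => bsum v (fun B =>
      koszul K (enl_f_sign a rs1 + block_sign a B rs2) *:
      T (head 0 rs1 :: block_shifts B rs2) (@pcons _ CH _ _ _ (F u) (mapD F B))))).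
apply: eq_ssum => W P1 P2 hP; have [lt_2 _] := plen_split_lt hP.
under eq_bsum do rewrite /= tsum_cons.
rewrite /bsum exchange_big /=; apply: eq_bigr => m _; rewrite -/(bsum _ _).
rewrite (IH _ _ P2 lt_2 m j (fun rs p => T (fs_sh X i :: rs)
  (@pcons _ CH _ _ _ (mxentry (enl_family P1) i m) p))); last first.
  by move=> rs; apply: ml_tail.
rewrite -exchange_tsum; apply: eq_tsum => rs2 v _ _ _.
transitivity (bsum v (fun B => tsum (Q := DQ) P1
    (fun rs1 (u : paths DQ (fs_ob X i) (fs_ob W m)) =>
      koszul K (enl_f_sign a rs1 + block_sign a B rs2) *:
      T (head 0 rs1 :: block_shifts B rs2) (@pcons _ CH _ _ _ (F u) (mapD F B))))).
  apply: eq_bsum => B.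
  rewrite entry_enl_family (lin_tsum _ _ (ml_head _ (hT _))) tsumZ.
  apply: eq_tsum => rs1 u e _ _.
  by rewrite (lin_scale (ml_head _ (hT _))) scalerA -koszulD addrC e.
exact: exchange_big.
Qed.

Lemma plen_npmap O O' (H : O -> O -> Type) (H' : O' -> O' -> Type) (f : O -> O')
    (G : forall X Y, H X Y -> H' (f X) (f Y)) X Y (p : npath H X Y) :
  plen (npmap G p) = plen p.
Proof. by elim: p => //= *; congr _.+1. Qed.

Lemma entry_enl_hpt_sum (X Y : fsum (ob C)) (P : paths EQ X Y) i j :
  mxentry (hpt_sum (S := enl_sdr a S) enl_family P) i j =
  tsum (Q := DQ) P (fun rs (p : paths DQ (fs_ob X i) (fs_ob Y j)) =>
    koszul K (enl_b_sign a rs) *: (hpt_sum F p : gsort _)).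
Proof.
(* The condition of having at least two blocks moves into [T], since a thread of the images has as
   many arrows as there are blocks. *)
pose T rs (p : paths C (fs_ob X i) (fs_ob Y j)) : Mor C (fs_ob X i) (fs_ob Y j) :=
  if (1 < plen p)%N then koszul K (enl_b_sign a rs) *: bop C p else 0.
have hT rs : multilinear (T rs).
  move=> k p q r h; have [h1 h2] := lincomb_plen h.
  rewrite /T h1 h2; case: ifP => _; last by rewrite scaler0 addr0.
  by have [hml _ _] := hC; rewrite (hml _ _ _ _ _ _ h) scalerDr !scalerA mulrC.
rewrite /mxentry /hpt_sum linear_sum big_mkcond /=.
transitivity (bsum P (fun B => tsum (mapE enl_family B) T)).
  apply: eq_bigr => B _; rewrite -/(mxentry _ i j).
  case: ifP => hB; rewrite ?entry_enl_b; last rewrite -(tsum0 _ (mapE enl_family B) i j);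
    by apply: eq_tsum => rs p _ _; rewrite plen_npmap /T => ->; rewrite hB.
rewrite bsum_tsum //; apply: eq_tsum => rs p _ _ _.
rewrite [in RHS]big_mkcond scaler_sumr; apply: eq_bigr => B _.
rewrite /T (@plen_npmap _ _ (paths DQ) CH (fun X => X)); case: ifP => _; last by rewrite !scaler0.
by rewrite scalerA -koszulD block_sign_shifts.
Qed.

End Family.

(** By induction the sum entering the recursion is the enlargement of the one for [C], with
    operation signs; the sign of the enlarged homotopy converts these into functor signs. *)
Lemma hpt_f_enl (X Y : fsum (ob C)) (P : paths EQ X Y) :
  hpt_f (S := enl_sdr a S) P = enl_family (@hpt_f K C S) P.
Proof.
elim/plen_ind: P => {}X {}Y P IH; apply: mxentryP => i j.
rewrite entry_enl_family.
case: P i j IH => [{}X {}Y A | {}X {}Y Z A P] i j IH.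
  rewrite tsum_one hpt_f_one (entry_enl_sdr_i a).
  by case: (a); rewrite /= ?big_nil scale1r.
rewrite hpt_f_cons /mxentry linearN /= -/(mxentry _ i j) (entry_enl_sdr_h a).
have -> : hpt_sum (S := enl_sdr a S) (hpt_f (S := enl_sdr a S)) (pcons A P) =
    hpt_sum (S := enl_sdr a S) (enl_family (@hpt_f K C S)) (pcons A P).
  rewrite !hpt_sumE; apply: eq_ssum => W u v huv.
  have [lt_v lt_u] := plen_split_lt huv; rewrite IH //.
  apply: (@eq_bsum_npmap _ _ _ EDH ECH (fun X => X) _ _ _ _ v
    (fun Q => bop (enl a C) (@pcons _ ECH _ _ _ (enl_family (@hpt_f K C S) u) Q))).
  by move=> X' Y' q hq; apply: IH; apply: leq_ltn_trans hq lt_v.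
rewrite entry_enl_hpt_sum.
pose L (x : Mor C (fs_ob X i) (fs_ob Z j)) := - (koszul K (fs_sh X i) *: sdr_h S x).
have hL : linear L.
  by move=> k x y; rewrite /L linearP scalerDr opprD !scalerN !scalerA mulrC.
rewrite -/(L _) (lin_tsum _ _ hL); apply: eq_tsum => rs p e _ hp.
rewrite /L [sdr_h S _]linearZ /= scalerA -koszulD -e koszul_enl_sign.
(* Threads of a longer sequence are longer too, so [hpt_f] is given there by its recursive
   clause. *)
have {hp} : (1 < plen p)%N by rewrite hp /= ltnS plen_gt0.
rewrite hpt_fE; case: p => //= *.
by rewrite sub0r scalerN.
Qed.

(** The enlarged projection carries no sign, so the operation signs of the sum pass through
    unchanged. *)
Lemma hpt_b_enl (X Y : fsum (ob C)) (P : paths EQ X Y) :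
  hpt_b (S := enl_sdr a S) P = enl_b a (C := hpt_cat S) P.
Proof.
apply: mxentryP => i j; rewrite [RHS]entry_enl_b.
case: P i j => [{}X {}Y A | {}X {}Y Z A P] i j.
  by rewrite tsum_one [LHS]entry_enl_retd enl_b_sign_one.
have e : @hpt_f K (enl a C) (enl_sdr a S) = enl_family (@hpt_f K C S).
  do 3!apply: functional_extensionality_dep => ?; exact: hpt_f_enl.
rewrite /= e (entry_enl_sdr_p a) entry_enl_hpt_sum.
rewrite (lin_tsum _ _ (@linearP _ _ _ _ (@sdr_p K C S _ _))).
apply: eq_tsum => rs p _ _ hp; rewrite linearZ /=; congr (_ *: _).
have {hp} : (1 < plen p)%N by rewrite hp /= ltnS plen_gt0.
by case: p.
Qed.

End EnlargedTransfer.

(** * Comparison of the two constructions *)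

Theorem theorem3p4 (K : fieldType) (C : ainf_pre K) (S : sdr_pre C)
    (a : enl_kind) (hC : is_ainf_cat C) (hS : is_sdr S) :
  let D := hpt_cat S in
  let f : prefunctor D C := hpt_functor S in
  let Ct := enl a C in
  let Dt := enl a D in
  let ft : prefunctor Dt Ct := enl_functor a f in
  let St : sdr_pre Ct := enl_sdr a S in
  let E := hpt_cat St in
  let g : prefunctor E Ct := hpt_functor St in
  [/\ is_ainf_cat D /\ is_ainf_qiso f,
      [/\ is_ainf_cat Ct, is_ainf_cat Dt & is_ainf_qiso ft],
      is_sdr St,
      is_ainf_cat E /\ is_ainf_qiso g
    & E = Dt /\ g = ft].
Proof.
move=> D f Ct Dt ft St E g.
have hCt : is_ainf_cat Ct by apply: enl_is_ainf_cat.
have hSt : is_sdr St by apply: enl_sdr_is_sdr.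
have hE : is_ainf_cat E by apply: hpt_is_ainf_cat.
have hg : is_ainf_qiso g by apply: hpt_is_ainf_qiso.
have eb : @hpt_b K Ct St = @enl_b K a D.
  by do 3!apply: functional_extensionality_dep => ?; exact: hpt_b_enl.
have ef : @hpt_f K Ct St = @enl_f K a D C f.
  by do 3!apply: functional_extensionality_dep => ?; exact: hpt_f_enl.
have eE : E = Dt.
  (* The underlying quivers are convertible, so equality of the operations suffices. *)
  exact: (f_equal (@AinfPre K (enl_quiver (ret S))) eb).
have eg : g = ft.
  (* [fsum_map] of the identity is convertible to the identity on formal sums, so both functors have
     the same object map. *)
  exact: (f_equal (@PreFunctor K (enl_quiver (ret S)) Ct (fun X => X)) ef).
have hft : is_ainf_qiso (D := Dt) (C := Ct) ft.
  rewrite -eg.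
  (* Exposing the operations of the source lets [eb] rewrite them; [g] keeps its type because
     prefunctors depend on the quivers only. *)
  change (is_ainf_qiso (D := AinfPre (quiv := enl_quiver (ret S)) (@enl_b K a D)) (C := Ct) g).
  by rewrite -eb.
split=> //; [split | split=> //].
- exact: hpt_is_ainf_cat.
- exact: hpt_is_ainf_qiso.
by rewrite -eE.
Qed.
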